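(* Let $\mathbb{F}$ be a field of characteristic different from $2$ and let $K_{10}$ be Kac's ten-dimensional Jordan superalgebra over $\mathbb{F}$. Then any twisted form of $K_{10}$ splits after a quadratic separable field extension, and for any such field extension $\mathbb{K}$ of $\mathbb{F}$, there is a unique (up to isomorphism) nontrivial twisted form of $K_{10}$ which splits over $\mathbb{K}$.
   Context: Superalgebras are $\mathbb{Z}_2$-graded (nonassociative) algebras, and isomorphisms preserve the $\mathbb{Z}_2$-grading; in an exponent of $-1$, a homogeneous element stands for its parity. The Kaplansky superalgebra $K_3$ over $\mathbb{F}$: $(K_3)_{\bar 0}=\mathbb{F}a$ and $(K_3)_{\bar 1}=W$ is a two-dimensional vector space with a nonzero skew-symmetric bilinear form $(\cdot\mid\cdot)$; the multiplication is $a^2=a$, $av=\frac12 v=va$, $vw=(v\mid w)a$ for $v,w\in W$. The form is extended to $K_3$ by making $(K_3)_{\bar 0}$ and $(K_3)_{\bar 1}$ orthogonal and $(a\mid a)=\frac12$. Kac's superalgebra $K_{10}=\mathbb{F}1\oplus(K_3\otimes_{\mathbb{F}}K_3)$ has $(K_{10})_{\bar 0}=\mathbb{F}1\oplus\mathbb{F}(a\otimes a)\oplus(W\otimes W)$ and $(K_{10})_{\bar 1}=(W\otimes a)\oplus(a\otimes W)$; the element $1$ is the unity and, for homogeneous $x,y,z,t\in K_3$, $$(x\otimes y)(z\otimes t)=(-1)^{yz}\Bigl(xz\otimes yt-\tfrac34 (x\mid z)(y\mid t)1\Bigr).$$ A twisted form of $K_{10}$ is an $\mathbb{F}$-superalgebra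 $\mathcal{A}$ such that $\mathcal{A}\otimes_{\mathbb{F}}\overline{\mathbb{F}}\cong K_{10}\otimes_{\mathbb{F}}\overline{\mathbb{F}}$ as $\overline{\mathbb F}$-superalgebras, where $\overline{\mathbb{F}}$ is an algebraic closure of $\mathbb{F}$. It is trivial if $\mathcal{A}\cong K_{10}$, and it splits over (or after) a field extension $\mathbb{K}/\mathbb{F}$ if $\mathcal{A}\otimes_{\mathbb{F}}\mathbb{K}\cong K_{10}\otimes_{\mathbb{F}}\mathbb{K}$ as $\mathbb{K}$-superalgebras.
   Formalization: The first claim is proved as ''any twisted form is trivial or splits after a quadratic separable field extension'', since over a field with no quadratic extension (e.g. algebraically closed) the trivial form splits over none. *)

(* Defs.v *)
From mathcomp Require Import all_boot all_algebra all_field ring.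

Set Implicit Arguments.
Unset Strict Implicit.
Unset Printing Implicit Defensive.

Import GRing.Theory.

Local Open Scope ring_scope.

(* Nonassociative, not necessarily unital, of arbitrary dimension.
   [sa_part false] is the even component and [sa_part true] the odd one, so
   that addition of parities is [addb]. *)
Record superalgebra (F : fieldType) := Superalgebra {
  sa_sort :> lmodType F;
  sa_mul : sa_sort -> sa_sort -> sa_sort;
  sa_part : bool -> sa_sort -> Prop;
  sa_mul_linearl : forall y : sa_sort, linear (fun x : sa_sort => sa_mul x y);
  sa_mul_linearr : forall x : sa_sort, linear (sa_mul x);
  sa_part0 : forall b, sa_part b 0;
  sa_part_linear : forall b (c : F) (x y : sa_sort),
    sa_part b x -> sa_part b y -> sa_part b (c *: x + y);
  sa_part_sum : forall x : sa_sort, exists x0 x1,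
    [/\ sa_part false x0, sa_part true x1 & x = x0 + x1];
  sa_part_direct : forall x : sa_sort,
    sa_part false x -> sa_part true x -> x = 0;
  sa_part_mul : forall b c (x y : sa_sort),
    sa_part b x -> sa_part c y -> sa_part (b (+) c) (sa_mul x y)
}.

Definition superalgebra_iso (F : fieldType) (A B : superalgebra F) : Prop :=
  exists f : {linear A -> B},
    [/\ bijective f,
        forall x y, f (sa_mul x y) = sa_mul (f x) (f y)
      & forall b x, sa_part b x <-> sa_part b (f x)].

(* [B], together with [j : x |-> x (x) 1], is the scalar extension of [A]
   along [iota : F -> L]: its underlying L-space is the tensor product of A
   and L over F (by the universal property of extension of scalars, among
   L-spaces of arbitrary dimension).  Since [j] spans [B], the product and the
   grading of [B] are determined by the two other clauses. *)
Definition is_scalar_extension (F L : fieldType) (iota : {rmorphism F -> L})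
    (A : superalgebra F) (B : superalgebra L)
    (j : {linear A -> B | iota \; *:%R}) : Prop :=
  [/\ forall (V : lmodType L) (f : {linear A -> V | iota \; *:%R}),
        exists g : {linear B -> V},
          (forall x, g (j x) = f x) /\
          (forall g' : {linear B -> V},
             (forall x, g' (j x) = f x) -> forall z, g' z = g z),
      forall x y, j (sa_mul x y) = sa_mul (j x) (j y)
    & forall b x, sa_part b x -> sa_part b (j x)].

Definition iso_over (F L : fieldType) (iota : {rmorphism F -> L})
    (A A' : superalgebra F) : Prop :=
  exists (B B' : superalgebra L)
         (j : {linear A -> B | iota \; *:%R})
         (j' : {linear A' -> B' | iota \; *:%R}),
    [/\ is_scalar_extension j, is_scalar_extension j'
      & superalgebra_iso B B'].

Section Kac.

Variable F : fieldType.

(* The Kaplansky superalgebra K_3 is carried by F^3: coordinate 0 is the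
   coefficient of a, coordinates 1 and 2 those of a basis v, w of W with
   (v | w) = 1; every nonzero skew-symmetric form on a plane over a field of
   characteristic not 2 has such a basis. *)
Definition k3_par (i : 'I_3) : bool := i != 0.

Definition k3_part (b : bool) (x : 'rV[F]_3) : Prop :=
  forall i, k3_par i != b -> x 0 i = 0.

Definition k3_skew (x y : 'rV[F]_3) : F := x 0 1 * y 0 2%:R - x 0 2%:R * y 0 1.

Definition k3_form (x y : 'rV[F]_3) : F := 2^-1 * (x 0 0 * y 0 0) + k3_skew x y.

Definition k3_mul (x y : 'rV[F]_3) : 'rV[F]_3 :=
  \row_i (if i == 0 then x 0 0 * y 0 0 + k3_skew x y
          else 2^-1 * (x 0 0 * y 0 i + y 0 0 * x 0 i)).

Definition k3_basis (i : 'I_3) : 'rV[F]_3 := delta_mx 0 i.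

(* K_3 (x) K_3 is realized as 3 x 3 matrices. *)
Definition k3_tens (x y : 'rV[F]_3) : 'M[F]_3 := x^T *m y.

(* (alpha, X) stands for alpha 1 + X. *)
Definition k10_space : lmodType F := (F^o * 'M[F]_3)%type.

(* (e_i (x) e_j)(e_k (x) e_l); lemma [k10_mul_tens] below extends the formula
   to all homogeneous tensors. *)
Definition k10_basis_mul (i j k l : 'I_3) : k10_space :=
  (-1) ^+ (k3_par j && k3_par k) *:
    ((- (3%:R / 4%:R) * (k3_form (k3_basis i) (k3_basis k) *
                         k3_form (k3_basis j) (k3_basis l)),
      k3_tens (k3_mul (k3_basis i) (k3_basis k))
              (k3_mul (k3_basis j) (k3_basis l))) : k10_space).

Definition k10_mul (u v : k10_space) : k10_space :=
  ((u.1 * v.1, u.1 *: v.2 + v.1 *: u.2) : k10_space) +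
  \sum_i \sum_j \sum_k \sum_l (u.2 i j * v.2 k l) *: k10_basis_mul i j k l.

Definition k10_part (b : bool) (u : k10_space) : Prop :=
  (b -> u.1 = 0) /\ (forall i j, k3_par i (+) k3_par j != b -> u.2 i j = 0).

Lemma k10_mul_linearl v : linear (fun u => k10_mul u v).
Proof.
move=> c x y; rewrite /k10_mul [in RHS]scalerDr [RHS]addrACA; congr (_ + _).
  congr (_, _) => /=; first by rewrite mulrDl -mulrA.
  by rewrite scalerDl -scalerA !scalerDr !scalerA [v.1 * c]mulrC addrACA.
rewrite scaler_sumr -big_split; apply: eq_bigr => i _.
rewrite scaler_sumr -big_split; apply: eq_bigr => j _.
rewrite scaler_sumr -big_split; apply: eq_bigr => k _.
rewrite scaler_sumr -big_split; apply: eq_bigr => l _ /=.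
by rewrite !mxE mulrDl scalerDl -mulrA scalerA.
Qed.

Lemma k10_mul_linearr u : linear (k10_mul u).
Proof.
move=> c x y; rewrite /k10_mul [in RHS]scalerDr [RHS]addrACA; congr (_ + _).
  congr (_, _) => /=; first by rewrite mulrDr mulrCA.
  by rewrite scalerDl -scalerA !scalerDr !scalerA [u.1 * c]mulrC addrACA.
rewrite scaler_sumr -big_split; apply: eq_bigr => i _.
rewrite scaler_sumr -big_split; apply: eq_bigr => j _.
rewrite scaler_sumr -big_split; apply: eq_bigr => k _.
rewrite scaler_sumr -big_split; apply: eq_bigr => l _ /=.
by rewrite !mxE mulrDr scalerDl mulrCA scalerA.
Qed.

Lemma k10_part0 b : k10_part b 0.
Proof. by split=> // i j _; rewrite mxE. Qed.

Lemma k10_part_linear b (c : F) (x y : k10_space) :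
  k10_part b x -> k10_part b y -> k10_part b (c *: x + y).
Proof.
move=> [x1 x2] [y1 y2]; split=> [hb|i j hij] /=.
  by rewrite x1 ?y1 // scaler0 addr0.
by rewrite !mxE x2 ?y2 // mulr0 addr0.
Qed.

Lemma k10_part_sum (x : k10_space) : exists x0 x1,
  [/\ k10_part false x0, k10_part true x1 & x = x0 + x1].
Proof.
pose m b := \matrix_(i, j) (if k3_par i (+) k3_par j == b then x.2 i j else 0).
exists (x.1, m false), (0, m true); split.
- by split=> // i j /= /negPf h; rewrite mxE h.
- by split=> // i j /= /negPf h; rewrite mxE h.
case: x @m => a X m; congr (_, _); rewrite /= ?addr0 //.
by apply/matrixP=> i j; rewrite !mxE; case: (_ (+) _); rewrite ?addr0 ?add0r.
Qed.

Lemma k10_part_direct (x : k10_space) :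
  k10_part false x -> k10_part true x -> x = 0.
Proof.
case: x => a X [_ h0] [h1 h2]; congr (_, _); first exact: h1.
apply/matrixP=> i j; rewrite mxE.
have [h|h] := boolP (k3_par i (+) k3_par j); first by apply: h0; rewrite h.
by apply: h2; rewrite (negPf h).
Qed.

Lemma k3_basis_part i : k3_part (k3_par i) (k3_basis i).
Proof.
by move=> j; rewrite mxE eqxx /=; case: (j =P i) => // ->; rewrite eqxx.
Qed.

Lemma k3_part_mul b c x y :
  k3_part b x -> k3_part c y -> k3_part (b (+) c) (k3_mul x y).
Proof.
have p0 : k3_par 0 = false by [].
have p1 : k3_par 1 = true by [].
have p2 : k3_par 2%:R = true by [].
move=> hx hy i; rewrite mxE; case: (i =P 0) => [->|/eqP i0].
  rewrite /k3_skew; case: b c hx hy => [] [] //= hx hy _.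
    by rewrite (hx 0) // (hy 1) // (hy 2%:R) // mul0r !mulr0 subrr addr0.
  by rewrite (hy 0) // (hx 1) // (hx 2%:R) // mulr0 !mul0r subrr addr0.
have pi : k3_par i = true by [].
case: b c hx hy => [] [] //= hx hy; rewrite pi // => _.
  by rewrite (hx 0) // (hy 0) // !mul0r addr0 mulr0.
by rewrite (hx i) ?pi // (hy i) ?pi // !mulr0 addr0 mulr0.
Qed.

Lemma k3_form_part b c x y :
  k3_part b x -> k3_part c y -> b != c -> k3_form x y = 0.
Proof.
have p0 : k3_par 0 = false by [].
have p1 : k3_par 1 = true by [].
have p2 : k3_par 2%:R = true by [].
rewrite /k3_form /k3_skew; case: b c => [] [] //= hx hy _.
  by rewrite (hx 0) // (hy 1) // (hy 2%:R) // mul0r !mulr0 subrr addr0.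
by rewrite (hy 0) // (hx 1) // (hx 2%:R) // !mulr0 !mul0r subrr addr0.
Qed.

Lemma k10_basis_mul_part i j k l :
  k10_part ((k3_par i (+) k3_par j) (+) (k3_par k (+) k3_par l))
           (k10_basis_mul i j k l).
Proof.
split=> [|m n] /=.
  case: (k3_par i =P k3_par k) => [->|/eqP hik].
    case: (k3_par j =P k3_par l) => [->|/eqP hjl _]; first by rewrite addbb.
    rewrite (k3_form_part (@k3_basis_part j) (@k3_basis_part l) hjl).
    by rewrite !mulr0 scaler0.
  rewrite (k3_form_part (@k3_basis_part i) (@k3_basis_part k) hik).
  by rewrite mul0r mulr0 scaler0.
rewrite addbACA mxE => h; rewrite /k3_tens mxE big_ord1 [_^T _ _]mxE.
have hi := k3_part_mul (@k3_basis_part i) (@k3_basis_part k).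
have hj := k3_part_mul (@k3_basis_part j) (@k3_basis_part l).
case: (k3_par m =P k3_par i (+) k3_par k) => [hm|/eqP hm].
  rewrite (hj n) ?mulr0 //; apply: contra h => /eqP <-.
  by rewrite hm.
by rewrite (hi m hm) mul0r mulr0.
Qed.

Lemma k10_part_mul b c (x y : k10_space) :
  k10_part b x -> k10_part c y -> k10_part (b (+) c) (k10_mul x y).
Proof.
move=> [x1 x2] [y1 y2].
have addP (u v : k10_space) : k10_part (b (+) c) u -> k10_part (b (+) c) v ->
    k10_part (b (+) c) (u + v).
  by move=> hu hv; rewrite -[u]scale1r; apply: k10_part_linear.
apply: (addP).
  split=> [|i j h] /=.
    case: (b) (c) x1 y1 => [] [] //= h1 h2 _; first by rewrite h1 // mul0r.
    by rewrite h2 // mulr0.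
  rewrite !mxE.
  have -> : x.1 * y.2 i j = 0.
    case: (b) x1 h => [->|_ h]; rewrite ?mul0r //.
    by rewrite y2 ?mulr0 //; move: h; case: (c).
  have -> : y.1 * x.2 i j = 0.
    case: (c) y1 h => [->|_ h]; rewrite ?mul0r //.
    by rewrite x2 ?mulr0 //; move: h; rewrite addbF.
  by rewrite addr0.
apply: (big_ind (k10_part _) (k10_part0 _) addP) => i _.
apply: (big_ind (k10_part _) (k10_part0 _) addP) => j _.
apply: (big_ind (k10_part _) (k10_part0 _) addP) => k _.
apply: (big_ind (k10_part _) (k10_part0 _) addP) => l _.
case: (k3_par i (+) k3_par j =P b) => [hb|/eqP hb]; last first.
  by rewrite x2 // mul0r scale0r; exact: k10_part0.
case: (k3_par k (+) k3_par l =P c) => [hc|/eqP hc]; last first.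
  by rewrite y2 // mulr0 scale0r; exact: k10_part0.
rewrite -[X in k10_part _ X]addr0; apply: k10_part_linear (k10_part0 _).
by rewrite -hb -hc; exact: k10_basis_mul_part.
Qed.

Definition K10 : superalgebra F :=
  Superalgebra k10_mul_linearl k10_mul_linearr k10_part0 k10_part_linear
    k10_part_sum k10_part_direct k10_part_mul.

Lemma k10_mul1l (u : K10) : sa_mul ((1, 0) : K10) u = u.
Proof.
case: u => a X; rewrite /= /k10_mul /= mul1r scale1r scaler0 addr0.
by do 4!rewrite big1 ?addr0 // => ? _; rewrite mxE mul0r scale0r.
Qed.

Lemma k10_mul1r (u : K10) : sa_mul u ((1, 0) : K10) = u.
Proof.
case: u => a X; rewrite /= /k10_mul /= mulr1 scale1r scaler0 add0r.
by do 4!rewrite big1 ?addr0 // => ? _; rewrite mxE mulr0 scale0r.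
Qed.

Lemma sum_ord3 (V : nmodType) (f : 'I_3 -> V) :
  \sum_i f i = f 0 + (f 1 + f 2%:R).
Proof.
rewrite !big_ord_recl big_ord0 addr0.
by congr (f _ + (f _ + f _)); apply: val_inj.
Qed.

Lemma k3_form_sum x y : k3_form x y =
  \sum_i \sum_k (x 0 i * y 0 k) * k3_form (k3_basis i) (k3_basis k).
Proof.
rewrite !sum_ord3 /k3_form /k3_skew !mxE /=; ring.
Qed.

Lemma k3_mul_sum x y m : k3_mul x y 0 m =
  \sum_i \sum_k (x 0 i * y 0 k) * k3_mul (k3_basis i) (k3_basis k) 0 m.
Proof.
rewrite !sum_ord3 /k3_mul /k3_skew !mxE.
have [->|->|->] : [\/ m = 0, m = 1 | m = 2%:R].
- by case: m => [[|[|[|m]]] lt_m3] //; [apply: Or31|apply: Or32|apply: Or33];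
    apply: val_inj.
- by rewrite /=; ring.
- by rewrite /=; ring.
- by rewrite /=; ring.
Qed.

Lemma k10_mul_tens b c (x y z t : 'rV[F]_3) :
  k3_part b y -> k3_part c z ->
  sa_mul ((0, k3_tens x y) : K10) ((0, k3_tens z t) : K10) =
  (-1) ^+ (b && c) *:
    ((- (3%:R / 4%:R) * (k3_form x z * k3_form y t),
      k3_tens (k3_mul x z) (k3_mul y t)) : K10).
Proof.
move=> hy hz; pose s : F := (-1) ^+ (b && c).
have sgnE i j k l (r : F) :
    (x 0 i * y 0 j) * (z 0 k * t 0 l) * ((-1) ^+ (k3_par j && k3_par k) * r) =
    s * ((x 0 i * z 0 k) * (y 0 j * t 0 l) * r).
  have [hj|/hy ->] := eqVneq (k3_par j) b; last by ring.
  have [hk|/hz ->] := eqVneq (k3_par k) c; last by ring.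
  by rewrite hj hk -/s; ring.
have sumE (p q : 'I_3 -> 'I_3 -> F) :
    \sum_i \sum_j \sum_k \sum_l p i k * q j l =
    (\sum_i \sum_k p i k) * (\sum_j \sum_l q j l).
  rewrite mulr_suml; apply: eq_bigr => i _; rewrite exchange_big mulr_suml.
  apply: eq_bigr => k _; rewrite mulr_sumr; apply: eq_bigr => j _.
  by rewrite mulr_sumr.
have tensE (u v : 'rV[F]_3) i j : k3_tens u v i j = u 0 i * v 0 j.
  by rewrite mxE big_ord1 mxE.
rewrite /= /k10_mul /= mulr0 !scale0r addr0 add0r.
rewrite [LHS]surjective_pairing; congr (_, _).
  rewrite /= (k3_form_sum x z) (k3_form_sum y t) -/s.
  rewrite -sumE mulr_sumr scaler_sumr (big_morph fst (id1 := 0) (op1 := +%R)) //.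
  apply: eq_bigr => i _; rewrite (big_morph fst (id1 := 0) (op1 := +%R)) //.
  rewrite mulr_sumr scaler_sumr; apply: eq_bigr => j _.
  rewrite (big_morph fst (id1 := 0) (op1 := +%R)) //.
  rewrite mulr_sumr scaler_sumr; apply: eq_bigr => k _.
  rewrite (big_morph fst (id1 := 0) (op1 := +%R)) //.
  rewrite mulr_sumr scaler_sumr; apply: eq_bigr => l _ /=.
  rewrite !tensE -[LHS]/(_ * (_ * _)) sgnE -[RHS]/(_ * _).
  by ring.
apply/matrixP => m n; rewrite [RHS]mxE tensE.
rewrite (k3_mul_sum x z) (k3_mul_sum y t) -sumE -/s mulr_sumr.
rewrite (big_morph snd (id1 := 0) (op1 := +%R)) // summxE.
apply: eq_bigr => i _; rewrite (big_morph snd (id1 := 0) (op1 := +%R)) // summxE.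
rewrite mulr_sumr; apply: eq_bigr => j _.
rewrite (big_morph snd (id1 := 0) (op1 := +%R)) // summxE.
rewrite mulr_sumr; apply: eq_bigr => k _.
rewrite (big_morph snd (id1 := 0) (op1 := +%R)) // summxE.
rewrite mulr_sumr; apply: eq_bigr => l _ /=.
rewrite mxE [X in _ * X]mxE !tensE sgnE.
by ring.
Qed.

End Kac.

Definition is_twisted_form (F Fbar : fieldType) (iota : {rmorphism F -> Fbar})
    (A : superalgebra F) : Prop :=
  iso_over iota A (K10 F).

Definition is_trivial_form (F : fieldType) (A : superalgebra F) : Prop :=
  superalgebra_iso A (K10 F).

Definition splits_over (F : fieldType) (K : fieldExtType F)
    (A : superalgebra F) : Prop :=
  iso_over (in_alg K) A (K10 F).

Definition quadratic_separable (F : fieldType) (K : fieldExtType F) : Prop :=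
  \dim {:K} = 2 /\ separable 1%VS {:K}%VS.

(* Main.v *)
From HB Require Import structures.
Require Import Defs.
From mathcomp Require Import all_boot all_algebra all_field ring.
From mathcomp Require boolp classical_sets.

Set Implicit Arguments.
Unset Strict Implicit.
Unset Printing Implicit Defensive.

Import GRing.Theory.
Local Open Scope ring_scope.

(** For odd elements [m = v (x) a + a (x) w] and [m' = v' (x) a + a (x) w'] of
    [K10], with [alpha = (v | v')] and [beta = (w | w')], one has
      [8 (m m') m = alpha v (x) a + beta a (x) w].
    In a twisted form [A] choose [m] and [m'] generic, so that [alpha] and [beta]
    are nonzero and distinct over the extension. The operator [x |-> 8 (m m') x]
    preserves the plane spanned by [v (x) a] and [a (x) w], its trace there is
    [2 (alpha + beta)] and its determinant is [alpha^2 + alpha beta + beta^2]; as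
    [m] is a cyclic vector defined over F, both lie in F, so [alpha + beta] and
    [alpha beta] do. Hence [alpha] and [beta] are the roots of a quadratic
    polynomial over F with discriminant [d = (alpha - beta)^2 <> 0], and
    multiplication by [sqrt d] on [W (x) a], by [- sqrt d] on [a (x) W], is defined
    on the odd part of [A]. Normalizing [m] and [m'] by means of this map and of
    the automorphism group SL2 x SL2 of [K10] gives a basis of [A] whose
    multiplication table depends only on [d]. The form with parameter [d] splits
    exactly over the extensions in which [d] is a square, and its isomorphism class
    only depends on [d] modulo squares. *)

(** * Linear maps and functionals on spaces of arbitrary dimension *)

Lemma linear_for_pack (R : pzRingType) (U : lmodType R) (V : zmodType)
    (s : GRing.Scale.law R V) (f : U -> V) :
  linear_for s f -> {g : {linear U -> V | s} | g =1 f}.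
Proof.
move=> hf; pose m := GRing.isLinear.Build R U V s f hf.
pose g : {linear U -> V | s} := HB.pack f m.
by exists g.
Qed.

Lemma linear_pack (R : pzRingType) (U V : lmodType R) (f : U -> V) :
  linear f -> {g : {linear U -> V} | g =1 f}.
Proof. exact: linear_for_pack. Qed.

Definition subspace (F : fieldType) (V : lmodType F) (U : V -> Prop) :=
  U 0 /\ forall (c : F) x y, U x -> U y -> U (c *: x + y).

(** A subspace [S] containing [U] and maximal among those avoiding [x] is a hyperplane complementary
    to the line of [x]; the functional is the coefficient of [x] modulo [S]. *)
Lemma separating_functional (F : fieldType) (V : lmodType F) (U : V -> Prop) x :
  subspace U -> ~ U x ->
  exists f : {linear V -> F^o}, (forall u, U u -> f u = 0) /\ f x = 1.
Proof.
move=> [U0 Ulin] nUx.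
pose P (S : classical_sets.set V) :=
  (forall y, ~ S y) \/ [/\ forall y, U y -> S y, subspace S & ~ S x].
have [|S [PS Smax]] := @classical_sets.Zorn_bigcup V P.
  move=> C CP Ctot; have [[X CX [y Xy]]|none] :=
    boolp.pselect (exists2 X, C X & exists y, X y); last first.
    by left=> y [X CX Xy]; apply: none; exists X => //; exists y.
  right; have big Y z : C Y -> Y z ->
      [/\ forall y, U y -> Y y, subspace Y & ~ Y x].
    by move=> CY Yz; case: (CP _ CY) => // h; case: (h z).
  have [UX [X0 _] _] := big _ _ CX Xy; split.
  - by move=> z Uz; exists X => //; apply: UX.
  - split=> [|c u v [Y CY Yu] [Z CZ Zv]]; first by exists X.
    have [YZ|ZY] := Ctot _ _ CY CZ.
      exists Z => //; have [_ [_ lin] _] := big _ _ CZ Zv.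
      by apply: lin => //; apply: YZ.
    exists Y => //; have [_ [_ lin] _] := big _ _ CY Yu.
    by apply: lin => //; apply: ZY.
  - by move=> [Y CY Yx]; have [_ _] := big _ _ CY Yx; apply.
have {PS} [US [S0 Slin] nSx] : [/\ forall y, U y -> S y, subspace S & ~ S x].
  case: PS => // Sempty; case: (Smax U); last by right.
  by split=> [y /Sempty//|h]; apply: (Sempty 0); apply: h.
have SZ c u : S u -> S (c *: u) by move=> Su; rewrite -[_ *: _]addr0; apply: Slin.
have SD u v : S u -> S v -> S (u + v).
  by move=> Su Sv; rewrite -[u]scale1r; apply: Slin.
(* If [y] is not in [S], then [S + F y] is strictly larger, so it contains [x] by maximality; the
   coefficient of [y] is nonzero and can be inverted. *)
have dec y : exists c, S (y - c *: x).
  have [Sy|nSy] := boolp.pselect (S y); first by exists 0; rewrite scale0r subr0.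
  pose T z := exists c, S (z - c *: y).
  have ST z : S z -> T z by move=> Sz; exists 0; rewrite scale0r subr0.
  have [[c Sc]|nTx] := boolp.pselect (T x); last first.
    case: (Smax T).
      split=> [z /ST//|h]; apply: nSy; apply: h.
      by exists 1; rewrite scale1r subrr.
    right; split=> [z /US/ST//||//]; split=> [|c u v [a Sa] [b Sb]].
      exact: ST.
    exists (c * a + b); have := Slin c _ _ Sa Sb.
    by rewrite scalerBr scalerA addrACA -opprD -scalerDl.
  have c0 : c != 0 by apply/eqP=> c0; apply: nSx; move: Sc; rewrite c0 scale0r subr0.
  exists c^-1; have := SZ (- c^-1) _ Sc.
  by rewrite scalerBr !scaleNr opprK scalerA mulVf // scale1r addrC.
have uniq y c c' : S (y - c *: x) -> S (y - c' *: x) -> c = c'.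
  move=> h h'; apply/eqP; rewrite -subr_eq0; apply/negPn/negP => n0.
  apply: nSx; have := SZ (c - c')^-1 _ (SD _ _ h' (SZ (-1) _ h)).
  rewrite scaleN1r opprB [X in _ *: X]addrC addrA subrK.
  by rewrite -scalerBl scalerA mulVf ?scale1r.
pose f y := projT1 (boolp.cid (dec y)).
have fP y : S (y - f y *: x) by rewrite /f; case: boolp.cid.
have [|g gE] := @linear_pack F V F^o f.
  move=> c u v; apply: (uniq (c *: u + v)); first exact: fP.
  have := Slin c _ _ (fP u) (fP v).
  by rewrite scalerBr scalerA addrACA -opprD -scalerDl.
exists g; split=> [u Uu|]; rewrite gE.
  by apply: (uniq u) (fP u) _; rewrite scale0r subr0; apply: US.
by apply: (uniq x) (fP x) _; rewrite scale1r subrr.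
Qed.

(** * Scalar extensions *)

Section ScalarExtension.

Variables (F L : fieldType) (iota : {rmorphism F -> L}).

Lemma semilinearZ (A : lmodType F) (B : lmodType L)
    (j : {linear A -> B | iota \; *:%R}) c x : j (c *: x) = iota c *: j x.
Proof. exact: linearZ. Qed.

(** Both maps factor the same semilinear map through [j], so the uniqueness clause applies.
    Identities over L are thereby checked on the image of A alone. *)
Lemma ext_eq (A : superalgebra F) (B : superalgebra L)
    (j : {linear A -> B | iota \; *:%R}) (V : lmodType L) (g g' : {linear B -> V}) :
  is_scalar_extension j -> (forall x, g (j x) = g' (j x)) -> g =1 g'.
Proof.
case=> univ _ _ gg'.
have [|f fE] := @linear_for_pack F A V (iota \; *:%R) (g \o j).
  by move=> c x y /=; rewrite linearP linearD linearZ.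
have [h [_ hu]] := univ V f.
by move=> z; rewrite (hu g) ?(hu g') // => x; rewrite fE /= ?gg'.
Qed.

Lemma ext_nonzero (A : superalgebra F) (B : superalgebra L)
    (j : {linear A -> B | iota \; *:%R}) (g : {linear B -> L^o}) z :
  is_scalar_extension j -> g z != 0 -> exists x, g (j x) != 0.
Proof.
move=> jext gz; apply: boolp.contrapT => none; move: gz.
rewrite (@ext_eq _ _ j L^o g \0 jext) ?eqxx // => x.
by apply/eqP/negPn/negP => h; apply: none; exists x.
Qed.

(* A subspace is cut out by its annihilator, so membership in it descends. *)
Lemma ext_mem (A : superalgebra F) (B : superalgebra L)
    (j : {linear A -> B | iota \; *:%R}) (U : A -> Prop) x :
  is_scalar_extension j -> subspace U ->
  (forall g : {linear B -> L^o}, (forall u, U u -> g (j u) = 0) -> g (j x) = 0) ->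
  U x.
Proof.
move=> [univ _ _] Usub gx; apply: boolp.contrapT => nUx.
have [f [fU fx]] := separating_functional Usub nUx.
have [|h hE] := @linear_for_pack F A L^o (iota \; *:%R) (fun y => iota (f y)).
  by move=> c y z; rewrite linearP rmorphD rmorphM.
have [g [gE _]] := univ L^o h.
have /eqP : g (j x) = 0.
  by apply: gx => u /fU fu; rewrite gE hE fu rmorph0.
by rewrite gE hE fx rmorph1 oner_eq0.
Qed.

Lemma ext_inj (A : superalgebra F) (B : superalgebra L)
    (j : {linear A -> B | iota \; *:%R}) x :
  is_scalar_extension j -> j x = 0 -> x = 0.
Proof.
move=> jext jx; apply: (@ext_mem _ _ j (fun y => y = 0)) => //.
  by split=> // c y z -> ->; rewrite scaler0 addr0.
by move=> g _; rewrite jx linear0.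
Qed.

(** Descent of scalars: when [j y] is nonzero, [a] must be the image of [c], hence comes from F. *)
Lemma ext_span1 (A : superalgebra F) (B : superalgebra L)
    (j : {linear A -> B | iota \; *:%R}) x y a :
  is_scalar_extension j -> j x = a *: j y -> exists c, x = c *: y.
Proof.
move=> jext jx.
apply: (@ext_mem _ _ j (fun x => exists c, x = c *: y)) => //.
  split=> [|c _ _ [a1 ->] [a2 ->]]; first by exists 0; rewrite scale0r.
  by exists (c * a1 + a2); rewrite scalerDl scalerA.
move=> g gy; rewrite jx linearZ /= gy ?scaler0 //.
by exists 1; rewrite scale1r.
Qed.

Lemma ext_span2 (A : superalgebra F) (B : superalgebra L)
    (j : {linear A -> B | iota \; *:%R}) x y z a b :
  is_scalar_extension j -> j x = a *: j y + b *: j z ->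
  exists c d, x = c *: y + d *: z.
Proof.
move=> jext jx.
apply: (@ext_mem _ _ j (fun x => exists c d, x = c *: y + d *: z)) => //.
  split=> [|c _ _ [a1 [b1 ->]] [a2 [b2 ->]]].
    by exists 0, 0; rewrite !scale0r addr0.
  exists (c * a1 + a2), (c * b1 + b2).
  by rewrite !scalerDl scalerDr !scalerA addrACA.
move=> g gy; rewrite jx linearD !linearZ /= !gy ?scaler0 ?addr0 //.
  by exists 0, 1; rewrite scale1r scale0r add0r.
by exists 1, 0; rewrite scale1r scale0r addr0.
Qed.

End ScalarExtension.

(** * Graded components and isomorphisms of superalgebras *)

Lemma sa_part_add (F : fieldType) (A : superalgebra F) b (x y : A) :
  sa_part b x -> sa_part b y -> sa_part b (x + y).
Proof. by move=> hx hy; rewrite -[x]scale1r; apply: sa_part_linear. Qed.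

Lemma sa_part_scale (F : fieldType) (A : superalgebra F) b c (x : A) :
  sa_part b x -> sa_part b (c *: x).
Proof.
by move=> hx; rewrite -[_ *: _]addr0; apply: sa_part_linear (sa_part0 _ _).
Qed.

Lemma sa_part_opp (F : fieldType) (A : superalgebra F) b (x : A) :
  sa_part b x -> sa_part b (- x).
Proof. by rewrite -scaleN1r; apply: sa_part_scale. Qed.

(** With linear projections, assertions about homogeneous elements become equalities of linear maps,
    to which [ext_eq] applies. *)
Lemma sa_projection (F : fieldType) (A : superalgebra F) b :
  exists p : {linear A -> A}, [/\ forall x, sa_part b (p x),
    forall x, sa_part b x -> p x = x & forall x, sa_part (~~ b) x -> p x = 0].
Proof.
have dec x : exists y : A, sa_part b y /\ sa_part (~~ b) (x - y).
  have [x0 [x1 [h0 h1 ->]]] := sa_part_sum x.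
  by case: b; [exists x1; rewrite addrK | exists x0; rewrite addrC addKr].
have uniq x (y z : A) : sa_part b y -> sa_part (~~ b) (x - y) ->
    sa_part b z -> sa_part (~~ b) (x - z) -> y = z.
  move=> hy hxy hz hxz; apply/eqP; rewrite -subr_eq0; apply/eqP.
  have h1 : sa_part b (y - z) by apply: sa_part_add (sa_part_opp _).
  have h2 : sa_part (~~ b) (y - z).
    by rewrite -(subrKA x) addrC; apply: sa_part_add => //; rewrite -opprB; apply: sa_part_opp.
  by case: (b) h1 h2 => h1 h2; apply: sa_part_direct.
pose p x := projT1 (boolp.cid (dec x)).
have pP x : sa_part b (p x) /\ sa_part (~~ b) (x - p x) by rewrite /p; case: boolp.cid.
have [|g gE] := @linear_pack F A A p.
  move=> c x y; have [[[hx hx'] [hy hy']] [hz hz']] := (pP x, pP y, pP (c *: x + y)).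
  apply: (uniq (c *: x + y)) => //; first exact: sa_part_linear.
  by rewrite opprD addrACA -scalerBr; apply: sa_part_linear.
exists g; split=> x; rewrite gE; have [hx hx'] := pP x => //.
  by move=> h; apply: (uniq x) => //; rewrite subrr; apply: sa_part0.
by move=> h; apply: (uniq x) => //; [apply: sa_part0 | rewrite subr0].
Qed.

Lemma superalgebra_iso_trans (F : fieldType) (A B C : superalgebra F) :
  superalgebra_iso A B -> superalgebra_iso B C -> superalgebra_iso A C.
Proof.
move=> [f [fb fm fp]] [g [gb gm gp]].
have [|h hE] := @linear_pack F A C (g \o f).
  by move=> c x y /=; rewrite !linearP.
exists h; split=> [|x y|b x].
- by apply: (eq_bij _ (fsym hE)); apply: bij_comp.
- by rewrite !hE /= fm gm.
- by rewrite hE /=; apply: (iff_trans (fp b x)).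
Qed.

Lemma superalgebra_iso_sym (F : fieldType) (A B : superalgebra F) :
  superalgebra_iso A B -> superalgebra_iso B A.
Proof.
move=> [f [[g fK gK] fm fp]].
have finj := can_inj fK.
have [|h hE] := @linear_pack F B A g.
  by move=> c x y; apply: finj; rewrite linearP !gK.
exists h; split=> [|x y|b x].
- by apply: (eq_bij _ (fsym hE)); exists f.
- by apply: finj; rewrite !hE fm !gK.
- by rewrite hE -[X in sa_part b X <-> _]gK; apply: iff_sym.
Qed.

Lemma linear_iso (F : fieldType) (A B : superalgebra F) (f : A -> B) (g : B -> A) :
  linear f -> cancel f g -> cancel g f ->
  (forall x y, f (sa_mul x y) = sa_mul (f x) (f y)) ->
  (forall b x, sa_part b x -> sa_part b (f x)) ->
  (forall b x, sa_part b x -> sa_part b (g x)) ->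
  exists h : {linear A -> B}, h =1 f /\
  [/\ bijective h, forall x y, h (sa_mul x y) = sa_mul (h x) (h y)
    & forall b x, sa_part b x <-> sa_part b (h x)].
Proof.
move=> lin fK gK fm fp gp; have [h hE] := linear_pack lin.
exists h; split=> //; split=> [|x y|b x]; rewrite ?hE //.
  by apply: (eq_bij _ (fsym hE)); exists g.
by split=> [/fp//|/gp]; rewrite fK.
Qed.

(** * Isomorphisms between scalar extensions, and descent *)

Section ExtensionIso.

Variables (F L : fieldType) (iota : {rmorphism F -> L}).

(** The universal properties give mutually inverse linear maps; product and grading are then
    compared on the images of A. *)
Lemma ext_iso (A : superalgebra F) (B B' : superalgebra L)
    (j : {linear A -> B | iota \; *:%R}) (j' : {linear A -> B' | iota \; *:%R}) :
  is_scalar_extension j -> is_scalar_extension j' -> superalgebra_iso B B'.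
Proof.
move=> jext jext'; have [[univ jm jp] [univ' jm' jp']] := (jext, jext').
have [g [gE _]] := univ _ j'; have [g' [gE' _]] := univ' _ j.
have gK : cancel g g'.
  have [|h hE] := @linear_pack L B B (g' \o g) => [c x y|x]; first by rewrite /= !linearP.
  have [|i iE] := @linear_pack L B B id => [c u v //|].
  rewrite -[RHS]iE -[LHS]hE; apply: (ext_eq jext) => y.
  by rewrite hE iE /= gE gE'.
have gK' : cancel g' g.
  have [|h hE] := @linear_pack L B' B' (g \o g') => [c x y|x]; first by rewrite /= !linearP.
  have [|i iE] := @linear_pack L B' B' id => [c u v //|].
  rewrite -[RHS]iE -[LHS]hE; apply: (ext_eq jext') => y.
  by rewrite hE iE /= gE' gE.
(* It suffices that [g] commutes with the projections onto the components, which can be tested on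
   [j A]. *)
have gpart b z : sa_part b z -> sa_part b (g z).
  have [p [pb pid p0]] := sa_projection B b.
  have [p' [pb' pid' p0']] := sa_projection B' b.
  move=> hz; rewrite -(pid z hz).
  have [|h hE] := @linear_pack L B B' (g \o p) => [c x y|]; first by rewrite /= !linearP.
  have [|h' hE'] := @linear_pack L B B' (p' \o g) => [c x y|]; first by rewrite /= !linearP.
  suff hh' : h z = h' z.
    have : g (p z) = p' (g z) by rewrite -[LHS]hE -[RHS]hE'.
    by move=> ->.
  apply: (ext_eq jext) => x; rewrite hE hE' /= gE.
  have [x0 [x1 [h0 h1 ->]]] := sa_part_sum x; rewrite !linearD.
  move: (jp _ _ h0) (jp _ _ h1) (jp' _ _ h0) (jp' _ _ h1) => k0 k1 k0' k1'.
  by case: (b) pid pid' p0 p0' => pid pid' p0 p0';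
     [rewrite (p0 _ k0) (pid _ k1) (p0' _ k0') (pid' _ k1')
     |rewrite (p0 _ k1) (pid _ k0) (p0' _ k1') (pid' _ k0')];
     rewrite linear0 gE.
exists g; split=> [|x y|b z]; first by exists g'.
(* Multiplicativity is extended one argument at a time: first to an arbitrary right factor, with the
   left one still in [j A]. *)
- have gm1 a z : g (sa_mul (j a) z) = sa_mul (j' a) (g z).
    have [|h hE] := @linear_pack L B B' (fun z => g (sa_mul (j a) z)) => [c u v|].
      by rewrite sa_mul_linearr linearP.
    have [|h' hE'] := @linear_pack L B B' (fun z => sa_mul (j' a) (g z)) => [c u v|].
      by rewrite linearP sa_mul_linearr.
    rewrite -hE -hE'; apply: (ext_eq jext) => b.
    by rewrite hE hE' -jm !gE jm'.
  have [|h hE] := @linear_pack L B B' (fun x => g (sa_mul x y)) => [c u v|].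
    by rewrite sa_mul_linearl linearP.
  have [|h' hE'] := @linear_pack L B B' (fun x => sa_mul (g x) (g y)) => [c u v|].
    by rewrite linearP sa_mul_linearl.
  rewrite -hE -hE'; apply: (ext_eq jext) => a.
  by rewrite hE hE' gm1 gE.
- split=> [|h]; first exact: gpart.
  have [z0 [z1 [h0 h1 zE]]] := sa_part_sum z.
  have zdir : g z = g z0 + g z1 by rewrite zE linearD.
  have d0 := gpart _ _ h0; have d1 := gpart _ _ h1.
  rewrite zE; case: (b) h => h.
    suff -> : z0 = 0 by rewrite add0r.
    apply: (can_inj gK); rewrite linear0; apply: sa_part_direct => //.
    rewrite -[g z0](addrK (g z1)) -zdir.
    by apply: sa_part_add (sa_part_opp _).
  suff -> : z1 = 0 by rewrite addr0.
  apply: (can_inj gK); rewrite linear0; apply: sa_part_direct => //.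
  rewrite -[g z1](addKr (g z0)) -zdir addrC.
  by apply: sa_part_add (sa_part_opp _).
Qed.

Lemma ext_isol (A A' : superalgebra F) (B : superalgebra L)
    (j : {linear A' -> B | iota \; *:%R}) :
  is_scalar_extension j -> superalgebra_iso A A' ->
  exists j' : {linear A -> B | iota \; *:%R}, is_scalar_extension j'.
Proof.
move=> [univ jm jp] [f [[f' fK fK'] fm fp]].
have finj := can_inj fK.
have [|h hE] := @linear_for_pack F A B (iota \; *:%R) (j \o f) => [c x y|].
  by rewrite /= !linearP.
exists h; split=> [V k|x y|b x /fp /jp]; rewrite ?hE //= ?fm ?jm //.
have [|k' kE] := @linear_for_pack F A' V (iota \; *:%R) (k \o f') => [c x y /=|].
  have -> : f' (c *: x + y) = c *: f' x + f' y.
    by apply: finj; rewrite linearP !fK'.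
  by rewrite linearP.
have [g [gE gu]] := univ V k'.
exists g; split=> [x|g' gE' z]; first by rewrite hE /= gE kE /= fK.
by apply: gu => y; rewrite kE /= -gE' hE /= fK'.
Qed.

Lemma ext_isor (A : superalgebra F) (B B' : superalgebra L)
    (j : {linear A -> B | iota \; *:%R}) (f : {linear B -> B'}) :
  is_scalar_extension j ->
  [/\ bijective f, forall x y, f (sa_mul x y) = sa_mul (f x) (f y)
    & forall b x, sa_part b x <-> sa_part b (f x)] ->
  exists j' : {linear A -> B' | iota \; *:%R},
    is_scalar_extension j' /\ j' =1 f \o j.
Proof.
move=> [univ jm jp] [[f' fK fK'] fm fp].
have finj := can_inj fK.
have [|h hE] := @linear_for_pack F A B' (iota \; *:%R) (f \o j) => [c x y|].
  by rewrite /= !linearP.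
exists h; split=> //.
split=> [V k|x y|b x /jp /fp]; rewrite ?hE //= ?jm ?fm //.
have [g [gE gu]] := univ V k.
have [|h1 hE1] := @linear_pack L B' V (g \o f') => [c x y /=|].
  have -> : f' (c *: x + y) = c *: f' x + f' y.
    by apply: finj; rewrite linearP !fK'.
  by rewrite linearP.
exists h1; split=> [x|g' gE' z]; first by rewrite hE hE1 /= fK gE.
have [|h2 hE2] := @linear_pack L B V (g' \o f) => [c x y|].
  by rewrite /= !linearP.
rewrite hE1 -[z in LHS]fK' -[g' _]hE2; apply: gu => x.
by rewrite hE2 -gE' hE.
Qed.

(** The component of the wrong parity is mapped into both parts of [B], hence to 0, and [j] is
    injective. *)
Lemma ext_part (A : superalgebra F) (B : superalgebra L)
    (j : {linear A -> B | iota \; *:%R}) b x :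
  is_scalar_extension j -> sa_part b (j x) -> sa_part b x.
Proof.
move=> jext; have [_ _ jp] := jext.
have [x0 [x1 [h0 h1 ->]]] := sa_part_sum x; rewrite linearD.
have [k0 k1] := (jp _ _ h0, jp _ _ h1); case: b => h.
  suff -> : x0 = 0 by rewrite add0r.
  apply: (ext_inj jext); apply: sa_part_direct => //.
  by rewrite -[j x0](addrK (j x1)); apply: sa_part_add (sa_part_opp _).
suff -> : x1 = 0 by rewrite addr0.
apply: (ext_inj jext); apply: sa_part_direct => //.
by rewrite -[j x1](addKr (j x0)) addrC; apply: sa_part_add (sa_part_opp _).
Qed.

(** Composing [g] with the projection onto the component [b] reduces this to [ext_nonzero]. It is
    the source of generic elements of A. *)
Lemma ext_homogeneous (A : superalgebra F) (B : superalgebra L)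
    (j : {linear A -> B | iota \; *:%R}) (g : {linear B -> L^o}) b z :
  is_scalar_extension j -> sa_part b z -> g z != 0 ->
  exists x, sa_part b x /\ g (j x) != 0.
Proof.
move=> jext zb gz; have [_ _ jp] := jext.
have [p [pb pid p0]] := sa_projection B b.
have [|h hE] := @linear_pack L B L^o (g \o p) => [c x y|].
  by rewrite /= !linearP.
have [|x] := @ext_nonzero _ _ _ _ _ j h z jext; first by rewrite hE /= pid.
have [x0 [x1 [h0 h1 ->]]] := sa_part_sum x; rewrite hE /= !linearD.
move: (jp _ _ h0) (jp _ _ h1) => k0 k1.
case: (b) pid p0 => pid p0.
  by rewrite (p0 _ k0) (pid _ k1) linear0 add0r; exists x1.
by rewrite (p0 _ k1) (pid _ k0) linear0 addr0; exists x0.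
Qed.

(** One inclusion between two F-forms inside [B] suffices: [k C] spans [B], so a functional
    vanishing on [k C] is zero, and [ext_mem] yields the reverse inclusion. *)
Lemma ext_image_iso (A C : superalgebra F) (B : superalgebra L)
    (j : {linear A -> B | iota \; *:%R}) (k : {linear C -> B | iota \; *:%R}) :
  is_scalar_extension j -> is_scalar_extension k ->
  (forall y, exists x, j x = k y) -> superalgebra_iso C A.
Proof.
move=> jext kext jk; have [[_ jm jp] [_ km kp]] := (jext, kext).
have jinj x y : j x = j y -> x = y.
  by move=> e; apply/subr0_eq/(ext_inj jext); rewrite linearB e subrr.
have kinj x y : k x = k y -> x = y.
  by move=> e; apply/subr0_eq/(ext_inj kext); rewrite linearB e subrr.
have kj x : exists y, j x = k y.
  apply: (@ext_mem _ _ _ _ _ j (fun x => exists y, j x = k y) x jext).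
    split=> [|c x1 x2 [y1 e1] [y2 e2]]; first by exists 0; rewrite !linear0.
    by exists (c *: y1 + y2); rewrite !linearP e1 e2.
  move=> g gU; have := @ext_eq _ _ _ _ _ k L^o g \0 kext; apply=> y.
  by have [z e] := jk y; rewrite -e gU //; exists y.
pose f y := projT1 (boolp.cid (jk y)); pose f' x := projT1 (boolp.cid (kj x)).
have fE y : j (f y) = k y by rewrite /f; case: boolp.cid.
have fE' x : k (f' x) = j x by rewrite /f'; case: boolp.cid.
have [||||||h [_ hP]] := @linear_iso F C A f f'.
- by move=> c x y; apply: jinj; rewrite fE !linearP !fE.
- by move=> y; apply: kinj; rewrite fE' fE.
- by move=> x; apply: jinj; rewrite fE fE'.
- by move=> x y; apply: jinj; rewrite fE jm !fE km.
- by move=> b x /kp; rewrite -fE => /(ext_part jext).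
- by move=> b x /jp; rewrite -fE' => /(ext_part kext).
by exists h.
Qed.

End ExtensionIso.

(** * Coordinates on [K10] *)

Lemma ord3_ind (P : 'I_3 -> Prop) : P 0 -> P 1 -> P 2%:R -> forall i, P i.
Proof.
move=> P0 P1 P2 [[|[|[|i]]] lti] //.
- by rewrite (_ : Ordinal lti = 0) //; apply: val_inj.
- by rewrite (_ : Ordinal lti = 1) //; apply: val_inj.
- by rewrite (_ : Ordinal lti = 2%:R) //; apply: val_inj.
Qed.

Section Coordinates.

Variable F : fieldType.

(** Ten named scalars, so that an identity in [K10] splits into scalar identities that [ring] or
    [field] decides. *)
Definition k10c (a x00 x01 x02 x10 x11 x12 x20 x21 x22 : F) : k10_space F :=
  (a, \matrix_(i, j)
    (if i == 0 then if j == 0 then x00 else if j == 1 then x01 else x02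
     else if i == 1 then if j == 0 then x10 else if j == 1 then x11 else x12
     else if j == 0 then x20 else if j == 1 then x21 else x22)).

Lemma k10_ext (u v : k10_space F) :
  u.1 = v.1 -> u.2 0 0 = v.2 0 0 -> u.2 0 1 = v.2 0 1 ->
  u.2 0 2%:R = v.2 0 2%:R -> u.2 1 0 = v.2 1 0 -> u.2 1 1 = v.2 1 1 ->
  u.2 1 2%:R = v.2 1 2%:R -> u.2 2%:R 0 = v.2 2%:R 0 ->
  u.2 2%:R 1 = v.2 2%:R 1 -> u.2 2%:R 2%:R = v.2 2%:R 2%:R -> u = v.
Proof.
case: u v => [a x] [b y] /= -> *; congr (_, _); apply/matrixP.
by apply: ord3_ind; apply: ord3_ind.
Qed.

Lemma k10cE (u : k10_space F) :
  u = k10c u.1 (u.2 0 0) (u.2 0 1) (u.2 0 2%:R) (u.2 1 0) (u.2 1 1) (u.2 1 2%:R)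
        (u.2 2%:R 0) (u.2 2%:R 1) (u.2 2%:R 2%:R).
Proof. by apply: k10_ext; rewrite /k10c ?mxE. Qed.

Lemma k10cP (P : k10_space F -> Prop) :
  (forall a x00 x01 x02 x10 x11 x12 x20 x21 x22,
     P (k10c a x00 x01 x02 x10 x11 x12 x20 x21 x22)) -> forall u, P u.
Proof. by move=> h u; rewrite (k10cE u). Qed.

Lemma k10c_lin (c : F) a x00 x01 x02 x10 x11 x12 x20 x21 x22
    b y00 y01 y02 y10 y11 y12 y20 y21 y22 :
  c *: k10c a x00 x01 x02 x10 x11 x12 x20 x21 x22 +
    k10c b y00 y01 y02 y10 y11 y12 y20 y21 y22 =
  k10c (c * a + b) (c * x00 + y00) (c * x01 + y01) (c * x02 + y02)
    (c * x10 + y10) (c * x11 + y11) (c * x12 + y12) (c * x20 + y20)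
    (c * x21 + y21) (c * x22 + y22).
Proof. by apply: k10_ext; rewrite /k10c /= ?mxE. Qed.

Lemma k10c_scale (c : F) a x00 x01 x02 x10 x11 x12 x20 x21 x22 :
  c *: k10c a x00 x01 x02 x10 x11 x12 x20 x21 x22 =
  k10c (c * a) (c * x00) (c * x01) (c * x02) (c * x10) (c * x11) (c * x12)
    (c * x20) (c * x21) (c * x22).
Proof. by apply: k10_ext; rewrite /k10c /= ?mxE. Qed.

Lemma k10c_add a x00 x01 x02 x10 x11 x12 x20 x21 x22
    b y00 y01 y02 y10 y11 y12 y20 y21 y22 :
  k10c a x00 x01 x02 x10 x11 x12 x20 x21 x22 +
    k10c b y00 y01 y02 y10 y11 y12 y20 y21 y22 =
  k10c (a + b) (x00 + y00) (x01 + y01) (x02 + y02) (x10 + y10) (x11 + y11)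
    (x12 + y12) (x20 + y20) (x21 + y21) (x22 + y22).
Proof. by apply: k10_ext; rewrite /k10c /= ?mxE. Qed.

Lemma k10_part_false a x00 x01 x02 x10 x11 x12 x20 x21 x22 :
  k10_part false (k10c a x00 x01 x02 x10 x11 x12 x20 x21 x22) <->
  [/\ x01 = 0, x02 = 0, x10 = 0 & x20 = 0].
Proof.
split=> [[_ h]|[-> -> -> ->]].
  by have := (h 0 1 isT, h 0 2%:R isT, h 1 0 isT, h 2%:R 0 isT);
     rewrite !mxE /= => -[[[-> ->] ->] ->].
by split=> //; apply: ord3_ind; apply: ord3_ind; rewrite ?mxE.
Qed.

Lemma k10_part_true a x00 x01 x02 x10 x11 x12 x20 x21 x22 :
  k10_part true (k10c a x00 x01 x02 x10 x11 x12 x20 x21 x22) <->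
  [/\ a = 0, x00 = 0 & [/\ x11 = 0, x12 = 0, x21 = 0 & x22 = 0]].
Proof.
split=> [[/(_ isT) /= -> h]|[-> -> [-> -> -> ->]]].
  by have := (h 0 0 isT, h 1 1 isT, h 1 2%:R isT, h 2%:R 1 isT, h 2%:R 2%:R isT);
     rewrite !mxE /= => -[[[[-> ->] ->] ->] ->].
by split=> //; apply: ord3_ind; apply: ord3_ind; rewrite ?mxE.
Qed.

Lemma k10_basis_mulE i j k l : k10_basis_mul F i j k l =
  ((-1) ^+ (k3_par j && k3_par k) * (- (3%:R / 4%:R) *
     (k3_form (k3_basis F i) (k3_basis F k) * k3_form (k3_basis F j) (k3_basis F l))),
   \matrix_(m, n) ((-1) ^+ (k3_par j && k3_par k) *
     (k3_mul (k3_basis F i) (k3_basis F k) 0 m *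
      k3_mul (k3_basis F j) (k3_basis F l) 0 n))).
Proof.
by congr (_, _); apply/matrixP => m n; rewrite !mxE big_ord1 !mxE.
Qed.

End Coordinates.

(** * The multiplication table of [K10] in coordinates *)

Section KacProduct.

Variable F : fieldType.

Lemma pow2_neq0 : 2%:R != 0 :> F ->
  [/\ 4%:R != 0 :> F, 8%:R != 0 :> F & 16%:R != 0 :> F].
Proof.
move=> h2; have h4 : 4%:R != 0 :> F by rewrite (natrM _ 2 2) mulf_neq0.
by rewrite (natrM _ 2 4) (natrM _ 4 4) !mulf_neq0.
Qed.

Lemma k3_form_contract (g : 'I_3 -> 'I_3 -> F) :
  \sum_i \sum_k k3_form (k3_basis F i) (k3_basis F k) * g i k =
  2^-1 * g 0 0 + g 1 2%:R - g 2%:R 1.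
Proof. by rewrite !sum_ord3 /k3_form /k3_skew !mxE /=; ring. Qed.

Lemma k3_mul_contract (g : 'I_3 -> 'I_3 -> F) m :
  \sum_i \sum_k k3_mul (k3_basis F i) (k3_basis F k) 0 m * g i k =
  if m == 0 then g 0 0 + g 1 2%:R - g 2%:R 1 else 2^-1 * (g 0 m + g m 0).
Proof.
rewrite !sum_ord3 !mxE /k3_skew !mxE /=.
by move: m; apply: ord3_ind; rewrite /=; ring.
Qed.

(** Regrouping the 81 terms by tensor factor allows the sparse structure constants of the Kaplansky
    superalgebra to be contracted one factor at a time. *)
Lemma k10_mul_contract (x y : 'M[F]_3) (p q : 'I_3 -> 'I_3 -> F) :
  \sum_i \sum_j \sum_k \sum_l (x i j * y k l) *
    ((-1) ^+ (k3_par j && k3_par k) * (p i k * q j l)) =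
  \sum_i \sum_k p i k * (\sum_j \sum_l q j l *
    ((-1) ^+ (k3_par j && k3_par k) * (x i j * y k l))).
Proof.
apply: eq_bigr => i _; rewrite exchange_big; apply: eq_bigr => k _.
rewrite mulr_sumr; apply: eq_bigr => j _; rewrite mulr_sumr.
by apply: eq_bigr => l _; ring.
Qed.

Lemma k10_mul_fst (u v : k10_space F) : (k10_mul u v).1 = u.1 * v.1 -
  3%:R / 4%:R * \sum_i \sum_k k3_form (k3_basis F i) (k3_basis F k) *
    (\sum_j \sum_l k3_form (k3_basis F j) (k3_basis F l) *
    ((-1) ^+ (k3_par j && k3_par k) * (u.2 i j * v.2 k l))).
Proof.
have sumE (f : 'I_3 -> k10_space F) : (\sum_i f i).1 = \sum_i (f i).1.
  by rewrite (big_morph fst (id1 := 0) (op1 := +%R)).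
rewrite -k10_mul_contract /k10_mul; congr (_ + _).
rewrite -mulNr mulr_sumr sumE; apply: eq_bigr => i _.
rewrite mulr_sumr sumE; apply: eq_bigr => j _.
rewrite mulr_sumr sumE; apply: eq_bigr => k _.
rewrite mulr_sumr sumE; apply: eq_bigr => l _.
rewrite k10_basis_mulE -[LHS]/(_ * (_ * (_ * _))); ring.
Qed.

Lemma k10_mul_snd (u v : k10_space F) m n :
  (k10_mul u v).2 m n = u.1 * v.2 m n + v.1 * u.2 m n +
  \sum_i \sum_k k3_mul (k3_basis F i) (k3_basis F k) 0 m *
    (\sum_j \sum_l k3_mul (k3_basis F j) (k3_basis F l) 0 n *
    ((-1) ^+ (k3_par j && k3_par k) * (u.2 i j * v.2 k l))).
Proof.
have sumE (f : 'I_3 -> k10_space F) : (\sum_i f i).2 m n = \sum_i (f i).2 m n.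
  by rewrite (big_morph snd (id1 := 0) (op1 := +%R)) // summxE.
rewrite -k10_mul_contract /k10_mul mxE; congr (_ + _); first by rewrite !mxE.
rewrite sumE; apply: eq_bigr => i _; rewrite sumE; apply: eq_bigr => j _.
rewrite sumE; apply: eq_bigr => k _; rewrite sumE; apply: eq_bigr => l _.
by rewrite k10_basis_mulE mxE [X in _ * X]mxE.
Qed.

Lemma k10_mulE (a x00 x01 x02 x10 x11 x12 x20 x21 x22 : F)
    b y00 y01 y02 y10 y11 y12 y20 y21 y22 : 2%:R != 0 :> F ->
  k10_mul (k10c a x00 x01 x02 x10 x11 x12 x20 x21 x22)
    (k10c b y00 y01 y02 y10 y11 y12 y20 y21 y22) =
  let: s := x01 * y02 - x02 * y01 in
  let: t := x10 * y20 - x20 * y10 in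
  let: q := x11 * y22 - x12 * y21 - x21 * y12 + x22 * y11 in
  k10c (a * b - 3%:R / 16%:R * (x00 * y00) - 3%:R / 8%:R * (s + t) + 3%:R / 4%:R * q)
    (a * y00 + b * x00 + x00 * y00 + s + t - q)
    (a * y01 + b * x01 + (x00 * y01 + x01 * y00 + x10 * y21 - x11 * y20
       - x20 * y11 + x21 * y10) / 2%:R)
    (a * y02 + b * x02 + (x00 * y02 + x02 * y00 + x10 * y22 - x12 * y20
       - x20 * y12 + x22 * y10) / 2%:R)
    (a * y10 + b * x10 + (x00 * y10 + x10 * y00 - x01 * y12 + x02 * y11
       + x11 * y02 - x12 * y01) / 2%:R)
    (a * y11 + b * x11 + (x00 * y11 + x11 * y00 - x01 * y10 + x10 * y01) / 4%:R)
    (a * y12 + b * x12 + (x00 * y12 + x12 * y00 - x02 * y10 + x10 * y02) / 4%:R)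
    (a * y20 + b * x20 + (x00 * y20 + x20 * y00 - x01 * y22 + x02 * y21
       + x21 * y02 - x22 * y01) / 2%:R)
    (a * y21 + b * x21 + (x00 * y21 + x21 * y00 - x01 * y20 + x20 * y01) / 4%:R)
    (a * y22 + b * x22 + (x00 * y22 + x22 * y00 - x02 * y20 + x20 * y02) / 4%:R).
Proof.
move=> h2; have [h4 h8 h16] := pow2_neq0 h2.
apply: k10_ext; rewrite ?k10_mul_fst ?k10_mul_snd ?k3_form_contract ?k3_mul_contract /=
  ?k3_form_contract ?k3_mul_contract !mxE /=.
all: field.
all: by rewrite ?h2 ?h4 ?h8 ?h16.
Qed.
End KacProduct.

(** * The twisted forms [K10d d] *)

Section TwistedProduct.

Variables (F : fieldType) (d : F).

(* With [c ^+ 2 = d], the coordinates are taken with respect to the following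
   elements of [K10] over F(c), where [e1], [e2] is the basis of [W]:
   [1]; 00: [4 a (x) a - 1]; 11: [2 c e1 (x) e1]; 22: [2 c e2 (x) e2];
   12: [2 (e1 (x) e2 - e2 (x) e1)]; 21: [2 c (e1 (x) e2 + e2 (x) e1)];
   i0: [4 (ei (x) a + a (x) ei)]; 0i: [4 c (ei (x) a - a (x) ei)].
   Their structure constants are polynomials in [d] with integer coefficients. *)
Definition kd_mul (u v : k10_space F) : k10_space F :=
  let x i j := u.2 i j in let y i j := v.2 i j in
  let a := u.1 in let b := v.1 in
  let s := x 1 0 * y 2%:R 0 - x 2%:R 0 * y 1 0 in
  let t := d * (x 0 1 * y 0 2%:R - x 0 2%:R * y 0 1) in
  let q := d * (x 1 1 * y 2%:R 2%:R + x 2%:R 2%:R * y 1 1)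
           + 2%:R * (x 1 2%:R * y 1 2%:R) - 2%:R * d * (x 2%:R 1 * y 2%:R 1) in
  k10c (a * b - 4%:R * (s + t) + 2%:R * q)
    (a * y 0 0 + b * x 0 0 + 2%:R * (x 0 0 * y 0 0) + 8%:R * (s + t) - q)
    ((a + x 0 0) * y 0 1 + (b + y 0 0) * x 0 1
     + (x 0 1 * y 1 2%:R + x 1 2%:R * y 0 1) - (x 1 0 * y 2%:R 1 + x 2%:R 1 * y 1 0)
     + (x 1 1 * y 2%:R 0 + x 2%:R 0 * y 1 1))
    ((a + x 0 0) * y 0 2%:R + (b + y 0 0) * x 0 2%:R
     + (x 0 2%:R * y 1 2%:R + x 1 2%:R * y 0 2%:R)
     - (x 1 0 * y 2%:R 2%:R + x 2%:R 2%:R * y 1 0)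
     + (x 2%:R 0 * y 2%:R 1 + x 2%:R 1 * y 2%:R 0))
    ((a + x 0 0) * y 1 0 + (b + y 0 0) * x 1 0
     + d * (x 0 1 * y 2%:R 1 + x 2%:R 1 * y 0 1)
     - d * (x 0 2%:R * y 1 1 + x 1 1 * y 0 2%:R)
     - (x 1 0 * y 1 2%:R + x 1 2%:R * y 1 0))
    (a * y 1 1 + b * x 1 1 + 4%:R * (x 0 1 * y 1 0 - x 1 0 * y 0 1))
    (a * y 1 2%:R + b * x 1 2%:R + 2%:R * (s - t))
    ((a + x 0 0) * y 2%:R 0 + (b + y 0 0) * x 2%:R 0
     + d * (x 0 1 * y 2%:R 2%:R + x 2%:R 2%:R * y 0 1)
     - d * (x 0 2%:R * y 2%:R 1 + x 2%:R 1 * y 0 2%:R)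
     - (x 1 2%:R * y 2%:R 0 + x 2%:R 0 * y 1 2%:R))
    (a * y 2%:R 1 + b * x 2%:R 1
     + 2%:R * (x 0 1 * y 2%:R 0 - x 2%:R 0 * y 0 1 + x 0 2%:R * y 1 0 - x 1 0 * y 0 2%:R))
    (a * y 2%:R 2%:R + b * x 2%:R 2%:R
     + 4%:R * (x 0 2%:R * y 2%:R 0 - x 2%:R 0 * y 0 2%:R)).

Lemma kd_mulE (a x00 x01 x02 x10 x11 x12 x20 x21 x22 : F)
    b y00 y01 y02 y10 y11 y12 y20 y21 y22 :
  kd_mul (k10c a x00 x01 x02 x10 x11 x12 x20 x21 x22)
    (k10c b y00 y01 y02 y10 y11 y12 y20 y21 y22) =
  let: s := x10 * y20 - x20 * y10 in
  let: t := d * (x01 * y02 - x02 * y01) in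
  let: q := d * (x11 * y22 + x22 * y11) + 2%:R * (x12 * y12)
           - 2%:R * d * (x21 * y21) in
  k10c (a * b - 4%:R * (s + t) + 2%:R * q)
    (a * y00 + b * x00 + 2%:R * (x00 * y00) + 8%:R * (s + t) - q)
    ((a + x00) * y01 + (b + y00) * x01 + (x01 * y12 + x12 * y01)
     - (x10 * y21 + x21 * y10) + (x11 * y20 + x20 * y11))
    ((a + x00) * y02 + (b + y00) * x02 + (x02 * y12 + x12 * y02)
     - (x10 * y22 + x22 * y10) + (x20 * y21 + x21 * y20))
    ((a + x00) * y10 + (b + y00) * x10 + d * (x01 * y21 + x21 * y01)
     - d * (x02 * y11 + x11 * y02) - (x10 * y12 + x12 * y10))
    (a * y11 + b * x11 + 4%:R * (x01 * y10 - x10 * y01))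
    (a * y12 + b * x12 + 2%:R * (s - t))
    ((a + x00) * y20 + (b + y00) * x20 + d * (x01 * y22 + x22 * y01)
     - d * (x02 * y21 + x21 * y02) - (x12 * y20 + x20 * y12))
    (a * y21 + b * x21 + 2%:R * (x01 * y20 - x20 * y01 + x02 * y10 - x10 * y02))
    (a * y22 + b * x22 + 4%:R * (x02 * y20 - x20 * y02)).
Proof. by rewrite /kd_mul !mxE. Qed.

Lemma kd_mul_linearl v : linear (fun u => kd_mul u v).
Proof.
move=> c; elim/k10cP: v => b y00 y01 y02 y10 y11 y12 y20 y21 y22.
elim/k10cP => a x00 x01 x02 x10 x11 x12 x20 x21 x22.
elim/k10cP => e z00 z01 z02 z10 z11 z12 z20 z21 z22.
by rewrite k10c_lin !kd_mulE k10c_lin; congr k10c; ring.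
Qed.

Lemma kd_mul_linearr u : linear (kd_mul u).
Proof.
move=> c; elim/k10cP: u => b y00 y01 y02 y10 y11 y12 y20 y21 y22.
elim/k10cP => a x00 x01 x02 x10 x11 x12 x20 x21 x22.
elim/k10cP => e z00 z01 z02 z10 z11 z12 z20 z21 z22.
by rewrite k10c_lin !kd_mulE k10c_lin; congr k10c; ring.
Qed.

Lemma kd_part_mul b c (x y : k10_space F) :
  k10_part b x -> k10_part c y -> k10_part (b (+) c) (kd_mul x y).
Proof.
elim/k10cP: x => a x00 x01 x02 x10 x11 x12 x20 x21 x22.
elim/k10cP: y => e y00 y01 y02 y10 y11 y12 y20 y21 y22.
rewrite kd_mulE; case: b c => [] [] /=.
- move=> /k10_part_true[-> -> [-> -> -> ->]] /k10_part_true[-> -> [-> -> -> ->]].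
  by apply/k10_part_false; split; ring.
- move=> /k10_part_true[-> -> [-> -> -> ->]] /k10_part_false[-> -> -> ->].
  by apply/k10_part_true; do !split; ring.
- move=> /k10_part_false[-> -> -> ->] /k10_part_true[-> -> [-> -> -> ->]].
  by apply/k10_part_true; do !split; ring.
- move=> /k10_part_false[-> -> -> ->] /k10_part_false[-> -> -> ->].
  by apply/k10_part_false; split; ring.
Qed.

Definition K10d : superalgebra F :=
  Superalgebra kd_mul_linearl kd_mul_linearr (@k10_part0 F) (@k10_part_linear F)
    (@k10_part_sum F) (@k10_part_direct F) kd_part_mul.

End TwistedProduct.

Section SplitProduct.

Variables (F : fieldType) (c : F).

(** Passage from the basis listed at [kd_mul], for a chosen square root [c] of the parameter, to the
    standard basis of [K10]. *)
Definition kd_split (u : k10_space F) : k10_space F :=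
  let x i j := u.2 i j in
  k10c (u.1 - x 0 0) (4%:R * x 0 0)
    (4%:R * (x 1 0 - c * x 0 1)) (4%:R * (x 2%:R 0 - c * x 0 2%:R))
    (4%:R * (x 1 0 + c * x 0 1)) (2%:R * c * x 1 1)
    (2%:R * (c * x 2%:R 1 + x 1 2%:R)) (4%:R * (x 2%:R 0 + c * x 0 2%:R))
    (2%:R * (c * x 2%:R 1 - x 1 2%:R)) (2%:R * c * x 2%:R 2%:R).

Definition kd_unsplit (u : k10_space F) : k10_space F :=
  let x i j := u.2 i j in
  k10c (u.1 + x 0 0 / 4%:R) (x 0 0 / 4%:R)
    ((x 1 0 - x 0 1) / (8%:R * c)) ((x 2%:R 0 - x 0 2%:R) / (8%:R * c))
    ((x 1 0 + x 0 1) / 8%:R) (x 1 1 / (2%:R * c))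
    ((x 1 2%:R - x 2%:R 1) / 4%:R) ((x 2%:R 0 + x 0 2%:R) / 8%:R)
    ((x 1 2%:R + x 2%:R 1) / (4%:R * c)) (x 2%:R 2%:R / (2%:R * c)).

Lemma kd_splitE (a x00 x01 x02 x10 x11 x12 x20 x21 x22 : F) :
  kd_split (k10c a x00 x01 x02 x10 x11 x12 x20 x21 x22) =
  k10c (a - x00) (4%:R * x00) (4%:R * (x10 - c * x01)) (4%:R * (x20 - c * x02))
    (4%:R * (x10 + c * x01)) (2%:R * c * x11) (2%:R * (c * x21 + x12))
    (4%:R * (x20 + c * x02)) (2%:R * (c * x21 - x12)) (2%:R * c * x22).
Proof. by rewrite /kd_split !mxE. Qed.

Lemma kd_unsplitE (a x00 x01 x02 x10 x11 x12 x20 x21 x22 : F) :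
  kd_unsplit (k10c a x00 x01 x02 x10 x11 x12 x20 x21 x22) =
  k10c (a + x00 / 4%:R) (x00 / 4%:R)
    ((x10 - x01) / (8%:R * c)) ((x20 - x02) / (8%:R * c))
    ((x10 + x01) / 8%:R) (x11 / (2%:R * c)) ((x12 - x21) / 4%:R)
    ((x20 + x02) / 8%:R) ((x12 + x21) / (4%:R * c)) (x22 / (2%:R * c)).
Proof. by rewrite /kd_unsplit !mxE. Qed.

Hypotheses (char2 : 2%:R != 0 :> F) (c0 : c != 0).

Lemma kd_split_iso : exists h : {linear K10d (c ^+ 2) -> K10 F}, h =1 kd_split /\
  [/\ bijective h, forall x y, h (sa_mul x y) = sa_mul (h x) (h y)
    & forall b x, sa_part b x <-> sa_part b (h x)].
Proof.
have [h4 h8 h16] := pow2_neq0 char2.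
apply: (@linear_iso F (K10d (c ^+ 2)) (K10 F) kd_split kd_unsplit).
- move=> e; elim/k10cP => a x00 x01 x02 x10 x11 x12 x20 x21 x22.
  elim/k10cP => b y00 y01 y02 y10 y11 y12 y20 y21 y22.
  by rewrite [X in kd_split X]k10c_lin !kd_splitE [RHS]k10c_lin; congr k10c; ring.
- elim/k10cP => a x00 x01 x02 x10 x11 x12 x20 x21 x22.
  by rewrite kd_splitE kd_unsplitE; congr k10c; field; rewrite ?c0 ?char2 ?h4 ?h8.
- elim/k10cP => a x00 x01 x02 x10 x11 x12 x20 x21 x22.
  by rewrite kd_unsplitE kd_splitE; congr k10c; field; rewrite ?c0 ?char2 ?h4 ?h8.
- elim/k10cP => a x00 x01 x02 x10 x11 x12 x20 x21 x22.
  elim/k10cP => b y00 y01 y02 y10 y11 y12 y20 y21 y22 /=.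
  rewrite kd_mulE !kd_splitE k10_mulE //.
  by congr k10c; field; rewrite ?char2 ?h4 ?h8 ?h16.
- move=> b; elim/k10cP => a x00 x01 x02 x10 x11 x12 x20 x21 x22.
  rewrite kd_splitE; case: b.
    by move=> /k10_part_true[-> -> [-> -> -> ->]]; apply/k10_part_true; do !split; ring.
  by move=> /k10_part_false[-> -> -> ->]; apply/k10_part_false; split; ring.
- move=> b; elim/k10cP => a x00 x01 x02 x10 x11 x12 x20 x21 x22.
  rewrite kd_unsplitE; case: b.
    by move=> /k10_part_true[-> -> [-> -> -> ->]]; apply/k10_part_true; do !split; ring.
  by move=> /k10_part_false[-> -> -> ->]; apply/k10_part_false; split; ring.
Qed.

(** The basis elements 01, 02, 11, 21 and 22 contain the square root of [d] as a factor, and that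
    root gets multiplied by [c]; the other five do not change. *)
Lemma kd_rescale_iso d : superalgebra_iso (K10d (c ^+ 2 * d)) (K10d d).
Proof.
pose f e (u : k10_space F) : k10_space F := let x i j := u.2 i j in
  k10c u.1 (x 0 0) (e * x 0 1) (e * x 0 2%:R) (x 1 0) (e * x 1 1) (x 1 2%:R)
    (x 2%:R 0) (e * x 2%:R 1) (e * x 2%:R 2%:R).
have fE e a x00 x01 x02 x10 x11 x12 x20 x21 x22 :
    f e (k10c a x00 x01 x02 x10 x11 x12 x20 x21 x22) =
    k10c a x00 (e * x01) (e * x02) x10 (e * x11) x12 x20 (e * x21) (e * x22).
  by rewrite /f !mxE.
have fp e b u : k10_part b u -> k10_part b (f e u).
  elim/k10cP: u => a x00 x01 x02 x10 x11 x12 x20 x21 x22; rewrite fE; case: b.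
    by move=> /k10_part_true[-> -> [-> -> -> ->]]; apply/k10_part_true; do !split; ring.
  by move=> /k10_part_false[-> -> -> ->]; apply/k10_part_false; split; ring.
have [||||||h [_ hP]] := @linear_iso F (K10d (c ^+ 2 * d)) (K10d d) (f c) (f c^-1).
- move=> e; elim/k10cP => a x00 x01 x02 x10 x11 x12 x20 x21 x22.
  elim/k10cP => b y00 y01 y02 y10 y11 y12 y20 y21 y22.
  by rewrite [X in f _ X]k10c_lin !fE [RHS]k10c_lin; congr k10c; ring.
- elim/k10cP => a x00 x01 x02 x10 x11 x12 x20 x21 x22.
  by rewrite !fE; congr k10c; field.
- elim/k10cP => a x00 x01 x02 x10 x11 x12 x20 x21 x22.
  by rewrite !fE; congr k10c; field.
- elim/k10cP => a x00 x01 x02 x10 x11 x12 x20 x21 x22.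
  elim/k10cP => b y00 y01 y02 y10 y11 y12 y20 y21 y22 /=.
  by rewrite kd_mulE !fE kd_mulE; congr k10c; ring.
- exact: fp.
- exact: fp.
by exists h.
Qed.

End SplitProduct.

Definition k10_one (F : fieldType) : k10_space F := (1, 0).
Definition k10_unit (F : fieldType) i j : k10_space F := (0, delta_mx i j).

Lemma k10_decomp (F : fieldType) (u : k10_space F) :
  u = u.1 *: k10_one F + \sum_i \sum_j u.2 i j *: k10_unit F i j.
Proof.
have sum1 (f : 'I_3 -> k10_space F) : (\sum_i f i).1 = \sum_i (f i).1.
  by rewrite (big_morph fst (id1 := 0) (op1 := +%R)).
have sum2 (f : 'I_3 -> k10_space F) : (\sum_i f i).2 = \sum_i (f i).2.
  by rewrite (big_morph snd (id1 := 0) (op1 := +%R)).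
rewrite [LHS]surjective_pairing [RHS]surjective_pairing; congr (_, _) => /=.
  rewrite sum1 big1 ?addr0 => [|i _]; first by rewrite -[LHS]mulr1.
  by rewrite sum1 big1 // => j _; rewrite /= scaler0.
rewrite scaler0 add0r sum2 {1}[u.2]matrix_sum_delta.
by apply: eq_bigr => i _; rewrite sum2.
Qed.

(** * Base change of the forms [K10d d], and splitting *)

Section BaseChange.

Variables (F L : fieldType) (iota : {rmorphism F -> L}).

Definition k10_map (u : k10_space F) : k10_space L := (iota u.1, map_mx iota u.2).

Lemma k10_mapE (a x00 x01 x02 x10 x11 x12 x20 x21 x22 : F) :
  k10_map (k10c a x00 x01 x02 x10 x11 x12 x20 x21 x22) =
  k10c (iota a) (iota x00) (iota x01) (iota x02) (iota x10) (iota x11)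
    (iota x12) (iota x20) (iota x21) (iota x22).
Proof. by apply: k10_ext; rewrite /k10_map ?mxE. Qed.

Lemma k10_map_linear : linear_for (iota \; *:%R) k10_map.
Proof.
move=> c u v; apply: k10_ext; rewrite /k10_map ?mxE /= ?rmorphD ?rmorphM //.
all: by rewrite !mxE.
Qed.

(** Basis vectors go to basis vectors, which gives the universal property; the structure constants
    are integer polynomials in [d], so [iota] respects them. *)
Lemma kd_ext d : exists j : {linear K10d d -> K10d (iota d) | iota \; *:%R},
  is_scalar_extension j /\ j =1 k10_map.
Proof.
have [j jE] := @linear_for_pack F (K10d d) (K10d (iota d)) (iota \; *:%R)
  k10_map k10_map_linear.
exists j; split=> //; split=> [V f|x y|b x].
- have [|g gE] := @linear_pack L (K10d (iota d)) V (fun z : k10_space L =>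
    z.1 *: f (k10_one F) + \sum_i \sum_j z.2 i j *: f (k10_unit F i j)).
    move=> c x y; rewrite scalerDr addrACA; congr (_ + _).
      by rewrite /= scalerDl scalerA.
    rewrite scaler_sumr -big_split; apply: eq_bigr => i _.
    rewrite scaler_sumr -big_split; apply: eq_bigr => k _.
    by rewrite /= !mxE scalerDl scalerA.
  exists g; split=> [x|g' gE' z].
    rewrite gE jE {3}(k10_decomp x) linearD linearZ; congr (_ + _).
    rewrite linear_sum; apply: eq_bigr => i _; rewrite linear_sum.
    by apply: eq_bigr => k _; rewrite linearZ /= mxE.
  have j1 : j (k10_one F) = k10_one L.
    by rewrite jE; congr (_, _); rewrite /= ?rmorph1 ?map_mx0.
  have jd i k : j (k10_unit F i k) = k10_unit L i k.
    by rewrite jE; congr (_, _); rewrite /= ?rmorph0 ?map_delta_mx.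
  rewrite gE {1}(k10_decomp z) linearD linearZ -j1 gE'; congr (_ + _).
  rewrite linear_sum; apply: eq_bigr => i _; rewrite linear_sum.
  by apply: eq_bigr => k _; rewrite linearZ -jd gE'.
- rewrite !jE /=; elim/k10cP: x => a x00 x01 x02 x10 x11 x12 x20 x21 x22.
  elim/k10cP: y => b y00 y01 y02 y10 y11 y12 y20 y21 y22.
  by rewrite kd_mulE !k10_mapE kd_mulE; congr k10c; ring.
- rewrite jE /=; elim/k10cP: x => a x00 x01 x02 x10 x11 x12 x20 x21 x22.
  rewrite k10_mapE; case: b.
    move=> /k10_part_true[-> -> [-> -> -> ->]].
    by rewrite !rmorph0; apply/k10_part_true.
  move=> /k10_part_false[-> -> -> ->].
  by rewrite !rmorph0; apply/k10_part_false.
Qed.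

Hypothesis char2 : 2%:R != 0 :> F.

Let char2L : 2%:R != 0 :> L.
Proof. by rewrite -(rmorph_nat iota) fmorph_eq0. Qed.

Definition k10_splits (A : superalgebra F) :=
  exists j : {linear A -> K10 L | iota \; *:%R}, is_scalar_extension j.

Lemma kd_ext_split d c : c != 0 -> c ^+ 2 = iota d ->
  exists j : {linear K10d d -> K10 L | iota \; *:%R},
    is_scalar_extension j /\ forall u, j u = kd_split c (k10_map u).
Proof.
move=> c0 cd; have [j [jext jE]] := kd_ext d.
have [h [hE hP]] := kd_split_iso char2L c0.
move: j jext jE; rewrite -cd => j jext jE.
have [j' [jext' jE']] := ext_isor jext hP; exists j'; split=> // u.
by rewrite jE' /= jE hE.
Qed.

Lemma kd_splits d c : c != 0 -> c ^+ 2 = iota d -> k10_splits (K10d d).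
Proof. by move=> c0 /(kd_ext_split c0)[j [jext _]]; exists j. Qed.

(** Uniqueness of scalar extensions replaces the two unspecified extensions in [iso_over] by [K10 L]
    itself. *)
Lemma iso_over_K10P A : iso_over iota A (K10 F) <-> k10_splits A.
Proof.
(* That [K10 L] extends [K10 F] comes from the form with parameter 1, which is isomorphic to
   [K10 F]. *)
have [j0 j0ext] : k10_splits (K10 F).
  have [j jext] : k10_splits (K10d (1 ^+ 2)).
    by apply: (@kd_splits _ 1); rewrite ?oner_eq0 ?rmorphXn ?rmorph1.
  have [h [_ hP]] := kd_split_iso char2 (oner_neq0 F).
  by apply: (ext_isol jext); apply: superalgebra_iso_sym; exists h.
split=> [[B [B' [j [j' [jext jext' BB']]]]]|[j jext]].
  have [f fP] := superalgebra_iso_trans BB' (ext_iso jext' j0ext).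
  by have [k [kext _]] := ext_isor jext fP; exists k.
exists (K10 L), (K10 L), j, j0; split=> //.
have [f fE] := @linear_pack L (K10 L) (K10 L) id (fun _ _ _ => erefl).
exists f; split=> [|x y|b x]; rewrite ?fE //.
by exists f => x; rewrite !fE.
Qed.

End BaseChange.

(** * The action of SL2 x SL2 *)

Section SL2Automorphism.

Variable F : fieldType.

(** The block matrix with 1 on [a] and rows [(p, q)], [(r, s)] on [W], acting on row vectors from
    the right; [k10c] just lists the entries. *)
Definition k3_gl (p q r s : F) : 'M[F]_3 := (k10c 0 1 0 0 0 p q 0 r s).2.

Lemma k3_glE p q r s (x : 'rV[F]_3) :
  [/\ (x *m k3_gl p q r s) 0 0 = x 0 0,
      (x *m k3_gl p q r s) 0 1 = x 0 1 * p + x 0 2%:R * r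
    & (x *m k3_gl p q r s) 0 2%:R = x 0 1 * q + x 0 2%:R * s].
Proof. by split; rewrite mxE sum_ord3 !mxE /=; ring. Qed.

Lemma k3_gl_inv p q r s : p * s - q * r = 1 ->
  k3_gl p q r s *m k3_gl s (- q) (- r) p = 1%:M.
Proof.
move=> det; apply/matrixP; apply: ord3_ind; apply: ord3_ind;
  rewrite mxE sum_ord3 !mxE /= ?mul0r ?mulr0 ?mul1r ?add0r ?addr0 //.
- by rewrite -det; ring.
- by ring.
- by ring.
- by rewrite -det; ring.
Qed.

Lemma k3_gl_skew p q r s x y : p * s - q * r = 1 ->
  k3_skew (x *m k3_gl p q r s) (y *m k3_gl p q r s) = k3_skew x y.
Proof.
have [_ x1 x2] := k3_glE p q r s x; have [_ y1 y2] := k3_glE p q r s y.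
move=> det; rewrite /k3_skew x1 x2 y1 y2 -[RHS]mul1r -det; ring.
Qed.

Lemma k3_gl_form p q r s x y : p * s - q * r = 1 ->
  k3_form (x *m k3_gl p q r s) (y *m k3_gl p q r s) = k3_form x y.
Proof.
move=> det; rewrite /k3_form k3_gl_skew //.
by have [-> _ _] := k3_glE p q r s x; have [-> _ _] := k3_glE p q r s y.
Qed.

Lemma k3_gl_mul p q r s x y : p * s - q * r = 1 ->
  k3_mul (x *m k3_gl p q r s) (y *m k3_gl p q r s) = k3_mul x y *m k3_gl p q r s.
Proof.
have [x0 x1 x2] := k3_glE p q r s x; have [y0 y1 y2] := k3_glE p q r s y.
have [z0 z1 z2] := k3_glE p q r s (k3_mul x y).
move=> det; apply/rowP; apply: ord3_ind.
- by rewrite z0 [LHS]mxE [RHS]mxE eqxx k3_gl_skew // x0 y0.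
- by rewrite z1 [LHS]mxE x0 x1 y0 y1 !mxE /=; ring.
- by rewrite z2 [LHS]mxE x0 x2 y0 y2 !mxE /=; ring.
Qed.

Lemma k3_gl_part p q r s b x : k3_part b x -> k3_part b (x *m k3_gl p q r s).
Proof.
have [x0 x1 x2] := k3_glE p q r s x.
move=> hx; apply: ord3_ind => h; rewrite ?x0 ?x1 ?x2.
- exact: hx.
- by rewrite (hx 1) // (hx 2%:R) // !mul0r addr0.
- by rewrite (hx 1) // (hx 2%:R) // !mul0r addr0.
Qed.

Lemma k10_unitE i j : k10_unit F i j = (0, k3_tens (k3_basis F i) (k3_basis F j)).
Proof. by rewrite /k3_tens trmx_delta mul_delta_mx. Qed.

Lemma k10_linear_eq (V : lmodType F) (f g : {linear k10_space F -> V}) :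
  f (k10_one F) = g (k10_one F) ->
  (forall i j, f (k10_unit F i j) = g (k10_unit F i j)) -> f =1 g.
Proof.
move=> fg1 fg u; rewrite (k10_decomp u) !linearD !linearZ fg1; congr (_ + _).
rewrite !linear_sum; apply: eq_bigr => i _; rewrite !linear_sum.
by apply: eq_bigr => j _; rewrite !linearZ fg.
Qed.

Section Transform.

Variables (p q r s p' q' r' s' : F).
Hypotheses (det : p * s - q * r = 1) (det' : p' * s' - q' * r' = 1).

(** As [x (x) y] is the matrix [x^T y], this is the tensor product of the two block matrices. *)
Definition k10_gl (u : k10_space F) : k10_space F :=
  (u.1, (k3_gl p q r s)^T *m u.2 *m k3_gl p' q' r' s').

Lemma k10_gl_linear : linear k10_gl.
Proof.
by move=> c u v; rewrite /k10_gl mulmxDr mulmxDl -scalemxAr -scalemxAl.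
Qed.

Lemma k10_gl_tens x y : k10_gl (0, k3_tens x y) =
  (0, k3_tens (x *m k3_gl p q r s) (y *m k3_gl p' q' r' s')).
Proof. by rewrite /k10_gl /k3_tens trmx_mul !mulmxA. Qed.

(** By bilinearity, products of basis tensors suffice; there [k10_mul_tens] applies, since maps of
    determinant 1 on [W] preserve parity, form and product. *)
Lemma k10_gl_mul u v : k10_gl (k10_mul u v) = k10_mul (k10_gl u) (k10_gl v).
Proof.
have [h hE] := linear_pack k10_gl_linear.
pose lm u := projT1 (linear_pack (@k10_mul_linearr F u)).
have lmE w : lm w =1 k10_mul w by rewrite /lm; case: linear_pack.
pose rm u := projT1 (linear_pack (@k10_mul_linearl F u)).
have rmE w : rm w =1 (fun u => k10_mul u w) by rewrite /rm; case: linear_pack.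
have one1 w : k10_mul (k10_one F) w = w := @k10_mul1l F w.
have one2 w : k10_mul w (k10_one F) = w := @k10_mul1r F w.
have h1 : h (k10_one F) = k10_one F.
  by rewrite hE /k10_gl mulmx0 mul0mx.
have hm i j k l : h (k10_mul (k10_unit F i j) (k10_unit F k l)) =
    k10_mul (h (k10_unit F i j)) (h (k10_unit F k l)).
  have mulT := @k10_mul_tens F; rewrite !hE !k10_unitE !k10_gl_tens.
  rewrite [k10_mul _ _](mulT _ _ _ _ _ _ (@k3_basis_part F j) (@k3_basis_part F k)).
  rewrite [RHS](mulT _ _ _ _ _ _ (k3_gl_part _ _ _ _ (@k3_basis_part F j))
    (k3_gl_part _ _ _ _ (@k3_basis_part F k))).
  rewrite -!hE linearZ !k3_gl_form // !k3_gl_mul //; congr (_ *: _).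
  by rewrite hE /k10_gl /k3_tens trmx_mul !mulmxA.
have hm1 i j w : h (k10_mul (k10_unit F i j) w) = k10_mul (h (k10_unit F i j)) (h w).
  rewrite -!lmE; apply: (@k10_linear_eq _ (h \o lm _) (lm _ \o h)) => [|k l] /=.
    by rewrite !lmE h1 !one2.
  by rewrite !lmE hm.
rewrite -!hE -!rmE.
apply: (@k10_linear_eq _ (h \o rm _) (rm _ \o h)) => [|i j] /=.
  by rewrite !rmE h1 !one1.
by rewrite !rmE hm1.
Qed.

End Transform.

Definition k10_odd (v1 v2 w1 w2 : F) : k10_space F := k10c 0 0 w1 w2 v1 0 0 v2 0 0.

Lemma k10_gl_odd p q r s p' q' r' s' v1 v2 w1 w2 :
  k10_gl p q r s p' q' r' s' (k10_odd v1 v2 w1 w2) =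
  k10_odd (v1 * p + v2 * r) (v1 * q + v2 * s) (w1 * p' + w2 * r') (w1 * q' + w2 * s').
Proof.
apply: k10_ext; rewrite //=.
all: by rewrite [LHS]mxE sum_ord3 !mxE !sum_ord3 !mxE /=; ring.
Qed.

Lemma k10_gl_iso p q r s p' q' r' s' :
  p * s - q * r = 1 -> p' * s' - q' * r' = 1 ->
  exists h : {linear K10 F -> K10 F}, h =1 k10_gl p q r s p' q' r' s' /\
  [/\ bijective h, forall x y, h (sa_mul x y) = sa_mul (h x) (h y)
    & forall b x, sa_part b x <-> sa_part b (h x)].
Proof.
have part a b c e a' b' c' e' z u :
    k10_part z u -> k10_part z (k10_gl a b c e a' b' c' e' u).
  elim/k10cP: u => x x00 x01 x02 x10 x11 x12 x20 x21 x22; case: z.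
    move=> /k10_part_true[-> -> [-> -> -> ->]]; rewrite -/(k10_odd _ _ _ _) k10_gl_odd.
    exact/k10_part_true.
  move=> /k10_part_false[-> -> -> ->]; rewrite [k10_gl _ _ _ _ _ _ _ _ _]k10cE.
  by apply/k10_part_false; split;
    rewrite [LHS]mxE sum_ord3 !mxE !sum_ord3 !mxE /=; ring.
have inv a b c e a' b' c' e' : a * e - b * c = 1 -> a' * e' - b' * c' = 1 ->
    cancel (k10_gl a b c e a' b' c' e') (k10_gl e (- b) (- c) a e' (- b') (- c') a').
  move=> d1 d2 u; rewrite /k10_gl /= !mulmxA -trmx_mul k3_gl_inv // trmx1 mul1mx.
  by rewrite -mulmxA k3_gl_inv // mulmx1 -surjective_pairing.
move=> d1 d2; apply: (@linear_iso F (K10 F) (K10 F) (k10_gl p q r s p' q' r' s')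
  (k10_gl s (- q) (- r) p s' (- q') (- r') p')).
- exact: k10_gl_linear.
- exact: inv.
- move=> u; rewrite -[X in _ = X](inv s (- q) (- r) p s' (- q') (- r') p') ?opprK //.
  + by rewrite -d1; ring.
  + by rewrite -d2; ring.
- by move=> x y; apply: k10_gl_mul.
- by move=> b x; apply: part.
- by move=> b x; apply: part.
Qed.

End SL2Automorphism.

(** * Classification *)

Section Generation.

Variables (F L : fieldType) (iota : {rmorphism F -> L}).
Hypothesis char2 : 2%:R != 0 :> F.

Let char2L : 2%:R != 0 :> L.
Proof. by rewrite -(rmorph_nat iota) fmorph_eq0. Qed.

(** Multiplied by 4, the four given elements become the odd basis elements of [K10d d]. Their
    products span only a hyperplane of the even part, so one more even element has to be found in A;
    then [ext_image_iso] applies. *)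
Lemma kd_iso_of_odd (A : superalgebra F) (j : {linear A -> K10 L | iota \; *:%R})
    d c m1 m2 n1 n2 :
  is_scalar_extension j -> c != 0 -> c ^+ 2 = iota d ->
  j m1 = k10_odd 1 0 1 0 -> j m2 = k10_odd 0 1 0 1 ->
  j n1 = k10_odd c 0 (- c) 0 -> j n2 = k10_odd 0 c 0 (- c) ->
  superalgebra_iso (K10d d) A.
Proof.
move=> jext c0 cd jm1 jm2 jn1 jn2.
have [h4 h8 h16] := pow2_neq0 char2; have [h4L h8L h16L] := pow2_neq0 char2L.
have d0 : d != 0 by rewrite -(fmorph_eq0 iota) -cd expf_neq0.
have [k [kext kE]] := kd_ext_split char2 c0 cd.
have [[_ jm jp] [_ km kp]] := (jext, kext).
pose Im (y : K10d d) := exists x, j x = k y.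
have ImD y z : Im y -> Im z -> Im (y + z).
  by move=> [x1 e1] [x2 e2]; exists (x1 + x2); rewrite !linearD e1 e2.
have ImZ e y : Im y -> Im (e *: y).
  by move=> [x ex]; exists (e *: x); rewrite !linearZ /= ex.
have ImM y z : Im y -> Im z -> Im (kd_mul d y z).
  by move=> [x1 e1] [x2 e2]; exists (sa_mul x1 x2); rewrite jm e1 e2 -km.
have ImV e y z : e != 0 -> Im z -> z = e *: y -> Im y.
  by move=> e0 zI zE; rewrite -[y](scalerK e0) -zE; apply: ImZ.
have M1 : Im (k10c 0 0 0 0 1 0 0 0 0 0).
  exists (4%:R *: m1); rewrite linearZ /= jm1 kE k10_mapE kd_splitE [LHS]k10c_scale.
  by rewrite !rmorph0 rmorph1; congr k10c; rewrite ?rmorph_nat; ring.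
have M2 : Im (k10c 0 0 0 0 0 0 0 1 0 0).
  exists (4%:R *: m2); rewrite linearZ /= jm2 kE k10_mapE kd_splitE [LHS]k10c_scale.
  by rewrite !rmorph0 rmorph1; congr k10c; rewrite ?rmorph_nat; ring.
have N1 : Im (k10c 0 0 1 0 0 0 0 0 0 0).
  exists (4%:R *: n1); rewrite linearZ /= jn1 kE k10_mapE kd_splitE [LHS]k10c_scale.
  by rewrite !rmorph0 rmorph1; congr k10c; rewrite ?rmorph_nat; ring.
have N2 : Im (k10c 0 0 0 1 0 0 0 0 0 0).
  exists (4%:R *: n2); rewrite linearZ /= jn2 kE k10_mapE kd_splitE [LHS]k10c_scale.
  by rewrite !rmorph0 rmorph1; congr k10c; rewrite ?rmorph_nat; ring.
have E11 : Im (k10c 0 0 0 0 0 1 0 0 0 0).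
  apply: (ImV (- 4%:R) _ _ _ (ImM _ _ M1 N1)); first by rewrite oppr_eq0.
  by rewrite [RHS]k10c_scale kd_mulE; congr k10c; ring.
have E22 : Im (k10c 0 0 0 0 0 0 0 0 0 1).
  apply: (ImV (- 4%:R) _ _ _ (ImM _ _ M2 N2)); first by rewrite oppr_eq0.
  by rewrite [RHS]k10c_scale kd_mulE; congr k10c; ring.
have E21 : Im (k10c 0 0 0 0 0 0 0 0 1 0).
  apply: (ImV (- 2%:R) _ _ _ (ImM _ _ M1 N2)); first by rewrite oppr_eq0.
  by rewrite [RHS]k10c_scale kd_mulE; congr k10c; ring.
(* In [d M1 M2 - N1 N2] the coordinates along 1 and 00 cancel; in the sum used for [G] the one along
   12 does. *)
have E12 : Im (k10c 0 0 0 0 0 0 1 0 0 0).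
  apply: (ImV (4%:R * d) _ _ _ (ImD _ _ (ImZ d _ (ImM _ _ M1 M2))
    (ImZ (- 1) _ (ImM _ _ N1 N2)))); first exact: mulf_neq0.
  by rewrite [RHS]k10c_scale !kd_mulE !k10c_scale [LHS]k10c_add; congr k10c; ring.
have G : Im (k10c (- 1) 2%:R 0 0 0 0 0 0 0 0).
  apply: (ImV (8%:R * d) _ _ _ (ImD _ _ (ImZ d _ (ImM _ _ M1 M2))
    (ImM _ _ N1 N2))); first exact: mulf_neq0.
  by rewrite [RHS]k10c_scale !kd_mulE !k10c_scale [LHS]k10c_add; congr k10c; ring.
(* With [z] the element at 00 and [g = 2 z - 1], an even [x] satisfies
   [g x + x = 2 t z] for a linear form [t]; as [z ^+ 2 = 2 z], squaring this
   element shows that [t] lies in F. *)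
have Z : Im (k10c 0 1 0 0 0 0 0 0 0 0).
  have [|g gE] := @linear_pack L (K10 L) L^o
    (fun u : k10_space L => u.1 + 3%:R / 4%:R * u.2 0 0).
    move=> e u v; rewrite -[LHS]/(e * u.1 + v.1 + 3%:R / 4%:R * (e *: u.2 + v.2) 0 0).
    rewrite -[RHS]/(e * (u.1 + _) + _) !mxE; ring.
  have [||x [x0 gx]] := @ext_homogeneous _ _ _ _ _ j g false (k10_one L) jext.
  - by split=> // i l _; rewrite mxE.
  - by rewrite gE /= mxE mulr0 addr0 oner_eq0.
  have [y yE] := G; pose w := sa_mul y x + x; pose t := g (j x).
  have kZ : k (k10c 0 1 0 0 0 0 0 0 0 0) = k10c (-1) 4%:R 0 0 0 0 0 0 0 0.
    by rewrite kE k10_mapE kd_splitE !rmorph0 rmorph1; congr k10c; ring.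
  have jw : j w = (2%:R * t) *: k (k10c 0 1 0 0 0 0 0 0 0 0).
    rewrite kZ /w linearD jm yE /t gE kE k10_mapE kd_splitE.
    move: (jp _ _ x0); elim/k10cP: (j x) => a a00 a01 a02 a10 a11 a12 a20 a21 a22.
    move=> /k10_part_false[-> -> -> ->].
    rewrite !rmorph0 rmorphN rmorph1 rmorph_nat [RHS]k10c_scale /= k10_mulE //.
    rewrite [LHS]k10c_add mxE /=.
    by congr k10c; field; rewrite ?char2L ?h4L ?h8L ?h16L.
  have jww : j (sa_mul w w) = (4%:R * t) *: j w.
    rewrite jm jw kZ !k10c_scale /= k10_mulE //.
    by congr k10c; field; rewrite ?char2L ?h4L ?h8L ?h16L.
  have [e wwE] := ext_span1 jext jww.
  have eE : iota e = 4%:R * t.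
    have := congr1 (fun u : k10_space L => u.1) jww.
    rewrite wwE semilinearZ jw kZ; apply: (@mulIf _ (2%:R * t * -1)).
    by rewrite mulrN1 oppr_eq0 mulf_neq0.
  have e0 : e != 0 by rewrite -(fmorph_eq0 iota) eE mulf_neq0.
  exists ((2%:R / e) *: w); rewrite semilinearZ jw scalerA fmorph_div eE rmorph_nat.
  by rewrite [X in X *: _](_ : _ = 1) ?scale1r //; field; rewrite gx h4L.
have I1 : Im (k10c 1 0 0 0 0 0 0 0 0 0).
  apply: (ImV 1 _ _ _ (ImD _ _ (ImZ 2%:R _ Z) (ImZ (- 1) _ G))); first exact: oner_neq0.
  by rewrite !k10c_scale [LHS]k10c_add; congr k10c; ring.
apply: (ext_image_iso jext kext).
elim/k10cP => a x00 x01 x02 x10 x11 x12 x20 x21 x22.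
rewrite [X in k X](_ : _ = a *: k10c 1 0 0 0 0 0 0 0 0 0 +
  (x00 *: k10c 0 1 0 0 0 0 0 0 0 0 + (x01 *: k10c 0 0 1 0 0 0 0 0 0 0 +
  (x02 *: k10c 0 0 0 1 0 0 0 0 0 0 + (x10 *: k10c 0 0 0 0 1 0 0 0 0 0 +
  (x11 *: k10c 0 0 0 0 0 1 0 0 0 0 + (x12 *: k10c 0 0 0 0 0 0 1 0 0 0 +
  (x20 *: k10c 0 0 0 0 0 0 0 1 0 0 + (x21 *: k10c 0 0 0 0 0 0 0 0 1 0 +
   x22 *: k10c 0 0 0 0 0 0 0 0 0 1))))))))); last first.
  by rewrite !k10c_scale !k10c_add; congr k10c; ring.
by do 9!(apply: (ImD); first exact: ImZ); apply: ImZ.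
Qed.

End Generation.

(** * Generic odd elements and their products *)

(** If neither [x] nor [y] serves, then [g x = 0] and [f y = 0], so [x + y] does. *)
Lemma common_nonzero (V L : zmodType) (P : V -> Prop) (f g : V -> L) x y :
  (forall x y, P x -> P y -> P (x + y)) ->
  {morph f : x y / x + y} -> {morph g : x y / x + y} ->
  P x -> P y -> f x != 0 -> g y != 0 -> exists z, [/\ P z, f z != 0 & g z != 0].
Proof.
move=> PD fD gD Px Py fx gy.
have [gx|gx] := eqVneq (g x) 0; last by exists x.
have [fy|fy] := eqVneq (f y) 0; last by exists y.
exists (x + y); split; first exact: PD.
  by rewrite fD fy addr0.
by rewrite gD gx add0r.
Qed.

(* Over a field with at least three elements no vector space is covered by
   three hyperplanes; here the hyperplanes are [f = 0], [g = 0] and [f = g]. *)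
Lemma common_nonzero_neq (V : zmodType) (L : fieldType) (P : V -> Prop)
    (f g : V -> L) x y z :
  2%:R != 0 :> L -> (forall x y, P x -> P y -> P (x + y)) ->
  (forall x, P x -> P (- x)) ->
  {morph f : x y / x + y} -> {morph g : x y / x + y} ->
  {morph f : x / - x} -> {morph g : x / - x} ->
  P x -> P y -> P z -> f x != 0 -> g y != 0 -> f z != g z ->
  exists t, [/\ P t, f t != 0, g t != 0 & f t != g t].
Proof.
move=> char2 PD PN fD gD fN gN Px Py Pz fx gy fgz.
have half (u v : L) : u + v = 0 -> u - v = 0 -> u = 0.
  move=> h1 h2; apply: (mulfI char2); rewrite mulr0 mulr_natl mulr2n.
  by rewrite -[X in X + _](subrK v) h2 add0r addrC.
have [t [Pt ft gt]] := common_nonzero PD fD gD Px Py fx gy.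
have [fgt|fgt] := eqVneq (f t) (g t); last by exists t.
(* Since [f t = g t], the maps differ at [t + z] and at [t - z]. As 2 is invertible, neither map
   vanishes at both points; if each point is killed by one of the maps, then [z] itself works. *)
have [f1|f1] := eqVneq (f t + f z) 0; last first.
  have [g1|g1] := eqVneq (g t + g z) 0; last first.
    exists (t + z); split; rewrite ?fD ?gD //; first exact: PD.
    by rewrite fgt (can_eq (addKr _)).
  have [f2|f2] := eqVneq (f t - f z) 0; last first.
    exists (t - z); split; rewrite ?fD ?gD ?fN ?gN //; first exact/PD/PN.
      by apply: contraNneq gt => /(half _ _ g1) ->.
    by rewrite fgt (can_eq (addKr _)) eqr_opp.
  exists z; split=> //; first by rewrite -(subr0_eq f2).
  by apply: contraNneq gt => gz; rewrite -g1 gz addr0.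
have [g2|g2] := eqVneq (g t - g z) 0.
  exists z; split=> //; last by rewrite -(subr0_eq g2).
  by apply: contraNneq ft => fz; rewrite -f1 fz addr0.
exists (t - z); split; rewrite ?fD ?gD ?fN ?gN //; first exact/PD/PN.
  by apply: contraNneq ft => /(half _ _ f1) ->.
by rewrite fgt (can_eq (addKr _)) eqr_opp.
Qed.

Section OddProducts.

Variable L : fieldType.
Hypothesis char2L : 2%:R != 0 :> L.

(** On coordinates [(x, y)] along [v (x) a] and [a (x) w], the operator has the matrix with rows
    [(a + b, - b)] and [(- a, a + b)]; this yields its trace and determinant. *)
Lemma k10_odd_triple (v1 v2 w1 w2 v1' v2' w1' w2' x y : L) :
  let a := v1 * v2' - v2 * v1' in let b := w1 * w2' - w2 * w1' in
  8%:R *: k10_mul (k10_mul (k10_odd v1 v2 w1 w2) (k10_odd v1' v2' w1' w2'))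
    (k10_odd (x * v1) (x * v2) (y * w1) (y * w2)) =
  k10_odd (((a + b) * x - b * y) * v1) (((a + b) * x - b * y) * v2)
    (((a + b) * y - a * x) * w1) (((a + b) * y - a * x) * w2).
Proof.
have [h4L h8L h16L] := pow2_neq0 char2L.
rewrite /k10_odd !k10_mulE // k10c_scale.
by congr k10c; field; rewrite ?char2L ?h4L ?h8L ?h16L.
Qed.

(** The operator multiplies the components of [m'] by [alpha] and [beta], exactly as it does those
    of [m]. *)
Lemma k10_odd_triple_right (v1 v2 w1 w2 v1' v2' w1' w2' : L) :
  let a := v1 * v2' - v2 * v1' in let b := w1 * w2' - w2 * w1' in
  8%:R *: k10_mul (k10_mul (k10_odd v1 v2 w1 w2) (k10_odd v1' v2' w1' w2'))
    (k10_odd v1' v2' w1' w2') = k10_odd (a * v1') (a * v2') (b * w1') (b * w2').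
Proof.
have [h4L h8L h16L] := pow2_neq0 char2L.
rewrite /k10_odd !k10_mulE // k10c_scale.
by congr k10c; field; rewrite ?char2L ?h4L ?h8L ?h16L.
Qed.

Lemma k10_odd_lin (e v1 v2 w1 w2 v1' v2' w1' w2' : L) :
  e *: k10_odd v1 v2 w1 w2 + k10_odd v1' v2' w1' w2' =
  k10_odd (e * v1 + v1') (e * v2 + v2') (e * w1 + w1') (e * w2 + w2').
Proof. by rewrite k10c_lin; congr k10c; ring. Qed.

Lemma k10_odd_scale (e v1 v2 w1 w2 : L) :
  e *: k10_odd v1 v2 w1 w2 = k10_odd (e * v1) (e * v2) (e * w1) (e * w2).
Proof. by rewrite k10c_scale; congr k10c; ring. Qed.

Lemma k10_oddE (u : k10_space L) : k10_part true u ->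
  u = k10_odd (u.2 1 0) (u.2 2%:R 0) (u.2 0 1) (u.2 0 2%:R).
Proof.
elim/k10cP: u => a x00 x01 x02 x10 x11 x12 x20 x21 x22.
by move=> /k10_part_true[-> -> [-> -> -> ->]]; rewrite !mxE.
Qed.

End OddProducts.

Section Classification.

Variables (F L : fieldType) (iota : {rmorphism F -> L}).
Hypothesis char2 : 2%:R != 0 :> F.

Let char2L : 2%:R != 0 :> L.
Proof. by rewrite -(rmorph_nat iota) fmorph_eq0. Qed.

(** Once [m] is fixed, [alpha], [beta] and [alpha - beta] are linear forms in [m'], each nonzero
    somewhere on the odd part over L, hence at an odd element of A. Nonzero [v1] and [w1] provide
    the explicit points and later allow coefficients to be compared. *)
Lemma generic_odd_pair (A : superalgebra F)
    (j : {linear A -> K10 L | iota \; *:%R}) :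
  is_scalar_extension j ->
  exists m n v1 v2 w1 w2 v1' v2' w1' w2',
    [/\ j m = k10_odd v1 v2 w1 w2, j n = k10_odd v1' v2' w1' w2',
        v1 != 0 /\ w1 != 0
      & [/\ v1 * v2' - v2 * v1' != 0, w1 * w2' - w2 * w1' != 0
          & v1 * v2' - v2 * v1' != w1 * w2' - w2 * w1']].
Proof.
move=> jext; have [_ _ jp] := jext.
have coord v1 v2 w1 w2 : exists g : {linear K10 L -> L^o}, forall u : k10_space L,
    g u = v1 * u.2 1 0 + v2 * u.2 2%:R 0 + (w1 * u.2 0 1 + w2 * u.2 0 2%:R).
  have [|g gE] := @linear_pack L (K10 L) L^o (fun u : k10_space L =>
    v1 * u.2 1 0 + v2 * u.2 2%:R 0 + (w1 * u.2 0 1 + w2 * u.2 0 2%:R)).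
    move=> e u v; rewrite /= !mxE.
    by rewrite -[RHS]/(e * _ + _); ring.
  by exists g.
have pick v1 v2 w1 w2 x1 x2 y1 y2 :
    v1 * x1 + v2 * x2 + (w1 * y1 + w2 * y2) != 0 -> exists x : A, sa_part true x /\
    v1 * (j x).2 1 0 + v2 * (j x).2 2%:R 0 +
      (w1 * (j x).2 0 1 + w2 * (j x).2 0 2%:R) != 0.
  move=> h; have [g gE] := coord v1 v2 w1 w2.
  have [||x [x1' gx]] := @ext_homogeneous _ _ _ _ _ j g true (k10_odd x1 x2 y1 y2) jext.
  - exact/k10_part_true.
  - by rewrite gE !mxE.
  - by exists x; rewrite gE in gx.
have PD (x y : A) : sa_part true x -> sa_part true y -> sa_part true (x + y).
  exact: sa_part_add.
have PN (x : A) : sa_part true x -> sa_part true (- x) by exact: sa_part_opp.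
have jD i k : {morph (fun x => (j x).2 i k) : x y / x + y}.
  by move=> x y; rewrite linearD mxE.
have jN i k : {morph (fun x => (j x).2 i k) : x / - x}.
  by move=> x; rewrite linearN mxE.
have [m [m1 mv mw]] : exists m, [/\ sa_part true m, (j m).2 1 0 != 0 & (j m).2 0 1 != 0].
  have [|x [Px fx]] := pick 1 0 0 0 1 0 0 0.
    by rewrite !mul0r !addr0 mul1r oner_eq0.
  have [|y [Py gy]] := pick 0 0 1 0 0 0 1 0.
    by rewrite !mul0r !addr0 !add0r mul1r oner_eq0.
  apply: (common_nonzero (x := x) (y := y) PD) => //.
    by rewrite !mul0r !addr0 mul1r in fx.
  by rewrite !mul0r !addr0 !add0r mul1r in gy.
pose v1 := (j m).2 1 0; pose v2 := (j m).2 2%:R 0.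
pose w1 := (j m).2 0 1; pose w2 := (j m).2 0 2%:R.
pose f x := v1 * (j x).2 2%:R 0 - v2 * (j x).2 1 0.
pose g x := w1 * (j x).2 0 2%:R - w2 * (j x).2 0 1.
have fD : {morph f : x y / x + y} by move=> x y; rewrite /f !jD; ring.
have gD : {morph g : x y / x + y} by move=> x y; rewrite /g !jD; ring.
have fN : {morph f : x / - x} by move=> x; rewrite /f !jN; ring.
have gN : {morph g : x / - x} by move=> x; rewrite /g !jN; ring.
have [x [Px fx]] : exists x, sa_part true x /\ f x != 0.
  have [|x [Px hx]] := pick (- v2) v1 0 0 0 1 0 0.
    by rewrite !mul0r !mulr0 mulr1 addr0 add0r addr0.
  by exists x; split=> //; move: hx; rewrite !mul0r !addr0 mulNr addrC.
have [y [Py gy]] : exists y, sa_part true y /\ g y != 0.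
  have [|y [Py hy]] := pick 0 0 (- w2) w1 0 0 0 1.
    by rewrite !mul0r !mulr0 mulr1 !add0r.
  by exists y; split=> //; move: hy; rewrite !mul0r !add0r mulNr addrC.
have [z [Pz fgz]] : exists z, sa_part true z /\ f z != g z.
  (* The form [f - g], tested at [e2 (x) a], where its value is [v1]. *)
  have [|z [Pz hz]] := pick (- v2) v1 w2 (- w1) 0 1 0 0.
    by rewrite !mulr0 mulr1 !addr0 add0r.
  exists z; split=> //; rewrite -subr_eq0; apply: contraNneq hz => e.
  by rewrite -e /f /g; apply/eqP; ring.
have [n [n1 fn gn fgn]] :=
  common_nonzero_neq char2L PD PN fD gD fN gN Px Py Pz fx gy fgz.
exists m, n, v1, v2, w1, w2.
exists ((j n).2 1 0), ((j n).2 2%:R 0), ((j n).2 0 1), ((j n).2 0 2%:R).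
by split=> //; apply/k10_oddE/jp.
Qed.

Lemma twisted_form_kd (A : superalgebra F) : k10_splits iota A ->
  exists d c, [/\ c != 0, c ^+ 2 = iota d & superalgebra_iso (K10d d) A].
Proof.
move=> [j jext]; have [_ jm _] := jext.
have [m [n [v1 [v2 [w1 [w2 [v1' [v2' [w1' [w2' []]]]]]]]]]] := generic_odd_pair jext.
set a := v1 * v2' - v2 * v1'; set b := w1 * w2' - w2 * w1'.
move=> jmE jnE [v0 w0] [a0 b0 ab].
have jlin e x f y : j (e *: x + f *: y) = iota e *: j x + iota f *: j y.
  by rewrite linearD !semilinearZ.
pose N x := 8%:R *: sa_mul (sa_mul m n) x.
have jN x y k : j k = k10_odd (x * v1) (x * v2) (y * w1) (y * w2) ->
    j (N k) = k10_odd (((a + b) * x - b * y) * v1) (((a + b) * x - b * y) * v2)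
      (((a + b) * y - a * x) * w1) (((a + b) * y - a * x) * w2).
  move=> jk; rewrite /N semilinearZ !jm jmE jnE jk rmorph_nat.
  exact: (k10_odd_triple char2L).
have jNm : j (N m) = k10_odd (a * v1) (a * v2) (b * w1) (b * w2).
  rewrite (jN 1 1); first by congr k10_odd; ring.
  by rewrite !mul1r.
have jNNm := jN _ _ _ jNm.
have jNn : j (N n) = k10_odd (a * v1') (a * v2') (b * w1') (b * w2').
  rewrite /N semilinearZ !jm jmE jnE rmorph_nat; exact: (k10_odd_triple_right char2L).
(* Cayley-Hamilton for [N] on the plane, applied to the cyclic vector [m]; [ext_span2] provides
   coefficients in F. *)
have [|e1 [e2 NNm]] := @ext_span2 _ _ _ _ _ j (N (N m)) (N m) m
    (2%:R * (a + b)) (- (a ^+ 2 + a * b + b ^+ 2)) jext.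
  by rewrite jNNm jNm jmE [X in _ = _ + X]k10_odd_scale k10_odd_lin; congr k10_odd; ring.
(* As [a] and [b] differ, the two coordinate equations determine both coefficients. *)
have [E1 E2] : iota e1 = 2%:R * (a + b) /\ iota e2 = - (a ^+ 2 + a * b + b ^+ 2).
  move: jNNm; rewrite NNm jlin jNm jmE [X in _ + X = _]k10_odd_scale k10_odd_lin => E.
  have Ev : iota e1 * a + iota e2 = (a + b) * a - b * b.
    apply: (mulIf v0); rewrite mulrDl -mulrA.
    by have := congr1 (fun u : k10_space L => u.2 1 0) E; rewrite !mxE.
  have Ew : iota e1 * b + iota e2 = (a + b) * b - a * a.
    apply: (mulIf w0); rewrite mulrDl -mulrA.
    by have := congr1 (fun u : k10_space L => u.2 0 1) E; rewrite !mxE.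
  have E1 : iota e1 = 2%:R * (a + b).
    apply: (@mulIf _ (a - b)); first by rewrite subr_eq0.
    transitivity ((iota e1 * a + iota e2) - (iota e1 * b + iota e2)); first by ring.
    by rewrite Ev Ew; ring.
  by split=> //; move: Ev; rewrite E1 => /(canRL (addKr _)) ->; ring.
(* These descend the sum, the product and the squared difference of [a] and [b]; the determinant is
   [s^2 - t]. *)
pose s := e1 / 2%:R; pose t := s ^+ 2 + e2; pose d := s ^+ 2 - 4%:R * t.
have sE : iota s = a + b by rewrite fmorph_div E1 rmorph_nat mulrAC divff // mul1r.
have tE : iota t = a * b by rewrite rmorphD rmorphXn sE E2; ring.
have dE : (a - b) ^+ 2 = iota d.
  by rewrite rmorphB rmorphM rmorphXn rmorph_nat sE tE; ring.
have t0 : t != 0 by rewrite -(fmorph_eq0 iota) tE mulf_neq0.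
clearbody d t s; exists d, (a - b); split; rewrite ?subr_eq0 //.
(* On [m] and [n] this multiplies the first component by [2 a - (a + b) = a - b] and the second by
   [b - a]. *)
pose D x := 2%:R *: N x - s *: x.
have jDm : j (D m) = k10_odd ((a - b) * v1) ((a - b) * v2)
    ((b - a) * w1) ((b - a) * w2).
  rewrite /D -scaleNr jlin jNm jmE [X in _ + X = _]k10_odd_scale k10_odd_lin.
  by rewrite rmorphN sE rmorph_nat; congr k10_odd; ring.
have jDn : j (D n) = k10_odd ((a - b) * v1') ((a - b) * v2')
    ((b - a) * w1') ((b - a) * w2').
  rewrite /D -scaleNr jlin jNn jnE [X in _ + X = _]k10_odd_scale k10_odd_lin.
  by rewrite rmorphN sE rmorph_nat; congr k10_odd; ring.
(* Since [(s - (a - b)) / (2 t) = 1 / a] and [(s - (b - a)) / (2 t) = 1 / b], both pairings of [m]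
   with [m2] are 1. Multiplication by [a - b] and [b - a] on the components, whose square is [d],
   takes [m2] to [n2]. *)
pose m2 := (s / (2%:R * t)) *: n + (- (2%:R * t)^-1) *: D n.
pose n2 := (s / (2%:R * t)) *: D n + (- (d / (2%:R * t))) *: n.
have jm2 : j m2 = k10_odd (v1' / a) (v2' / a) (w1' / b) (w2' / b).
  rewrite jlin jnE jDn [X in _ + X = _]k10_odd_scale k10_odd_lin.
  rewrite rmorphN fmorphV fmorph_div rmorphM rmorph_nat sE tE.
  by congr k10_odd; field; rewrite ?char2L ?a0 ?b0.
have jn2 : j n2 = k10_odd ((a - b) * (v1' / a)) ((a - b) * (v2' / a))
    ((b - a) * (w1' / b)) ((b - a) * (w2' / b)).
  rewrite jlin jnE jDn [X in _ + X = _]k10_odd_scale k10_odd_lin.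
  rewrite rmorphN !fmorph_div rmorphM rmorph_nat sE tE -dE.
  by congr k10_odd; field; rewrite ?char2L ?a0 ?b0.
(* The inverse of the matrix with rows [v] and [v' / a], and likewise for [w]: both symplectic pairs
   go to the standard basis of [W]. *)
have [||h [hE hP]] := @k10_gl_iso L (v2' / a) (- v2) (- (v1' / a)) v1
  (w2' / b) (- w2) (- (w1' / b)) w1.
- by rewrite -[RHS](divff a0) {3}/a; ring.
- by rewrite -[RHS](divff b0) {3}/b; ring.
have [k [kext kE]] := ext_isor jext hP.
have va : v1 * (v2' / a) - v2 * (v1' / a) = 1.
  by rewrite -[RHS](divff a0) {3}/a; ring.
have wb : w1 * (w2' / b) - w2 * (w1' / b) = 1.
  by rewrite -[RHS](divff b0) {3}/b; ring.
apply: (@kd_iso_of_odd _ _ _ char2 A k d (a - b) m m2 (D m) n2) => //.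
- by rewrite subr_eq0.
- rewrite kE /= hE jmE k10_gl_odd; congr k10_odd.
  + by rewrite -[RHS]va; ring.
  + by ring.
  + by rewrite -[RHS]wb; ring.
  + by ring.
- rewrite kE /= hE jm2 k10_gl_odd; congr k10_odd.
  + by ring.
  + by rewrite -[RHS]va; ring.
  + by ring.
  + by rewrite -[RHS]wb; ring.
- rewrite kE /= hE jDm k10_gl_odd; congr k10_odd.
  + by rewrite -[RHS]mulr1 -va; ring.
  + by ring.
  + by rewrite -[RHS]mulr1 -wb; ring.
  + by ring.
- rewrite kE /= hE jn2 k10_gl_odd; congr k10_odd.
  + by ring.
  + by rewrite -[RHS]mulr1 -va; ring.
  + by ring.
  + by rewrite -[RHS]mulr1 -wb; ring.
Qed.

End Classification.

(** * The parameter of a trivial form *)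

(** With [c^2 = d] and [n = x^2 - d y^2], the hypotheses are the coefficients of
    [2 n c (x + y c) = mu (x + y c)]. If [n = 0] then [d = (x / y)^2]; otherwise applying the
    relation twice gives [d = (mu / (2 n))^2]. *)
Lemma square_of_proportional (F : fieldType) (d x y mu : F) : 2%:R != 0 :> F ->
  ~~ ((x == 0) && (y == 0)) ->
  2%:R * (x ^+ 2 - d * y ^+ 2) * x = mu * y ->
  2%:R * (x ^+ 2 - d * y ^+ 2) * (d * y) = mu * x -> exists e, d = e ^+ 2.
Proof.
move=> char2 xy0; set n := x ^+ 2 - d * y ^+ 2 => ex ey.
have [n0|n0] := eqVneq n 0.
  have xd : x ^+ 2 = d * y ^+ 2 by apply/subr0_eq.
  have y0 : y != 0.
    apply: contraNneq xy0 => y0; move/eqP: xd.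
    by rewrite y0 eqxx andbT expr0n mulr0 expf_eq0.
  by exists (x / y); rewrite expr_div_n xd mulfK ?expf_neq0.
have n2 : 2%:R * n != 0 by rewrite mulf_neq0.
exists (mu / (2%:R * n)); rewrite expr_div_n; apply: (canRL (mulfK _)).
  by rewrite expf_neq0.
have dx : d * (2%:R * n) ^+ 2 * x = mu ^+ 2 * x.
  transitivity (2%:R * n * (d * (2%:R * n * x))); first by ring.
  rewrite ex; transitivity (mu * (2%:R * n * (d * y))); first by ring.
  by rewrite ey; ring.
have dy : d * (2%:R * n) ^+ 2 * y = mu ^+ 2 * y.
  transitivity (2%:R * n * (2%:R * n * (d * y))); first by ring.
  by rewrite ey; transitivity (mu * (2%:R * n * x)); [ring | rewrite ex; ring].
have [x0|/mulIf inj] := eqVneq x 0; last exact: inj.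
by move: xy0; rewrite x0 eqxx => /mulIf; apply.
Qed.

(* In [K10] the odd element [m = v (x) a] satisfies [(m n) m = mu m] for all
   odd [n]; a nonzero element of [K10d d] with this property gives a square
   root of [d]. *)
Lemma trivial_kd_square (F : fieldType) (d : F) : 2%:R != 0 :> F ->
  superalgebra_iso (K10d d) (K10 F) -> exists e, d = e ^+ 2.
Proof.
move=> char2 [f [[f' fK fK'] fm fp]].
have h8 : 8%:R != 0 :> F by have [_] := pow2_neq0 char2.
pose m : K10d d := f' (k10_odd 1 0 0 0).
have fmE : f m = k10_odd 1 0 0 0 := fK' _.
have modd : k10_part true m by apply/(fp true m); rewrite fmE; apply/k10_part_true.
have prop n : k10_part true n -> exists mu, kd_mul d (kd_mul d m n) m = mu *: m.
  move=> nodd; have := fp true n; case=> /(_ nodd)/k10_oddE => fnE _.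
  pose a := (f n).2 2%:R 0; exists (a / 8%:R).
  apply: (can_inj fK); rewrite linearZ.
  apply: (scalerI h8); rewrite scalerA mulrCA divff // mulr1.
  rewrite (fm (kd_mul d m n) m) (fm m n) fmE fnE.
  have := k10_odd_triple char2 1 0 0 0 ((f n).2 1 0) a ((f n).2 0 1)
    ((f n).2 0 2%:R) 1 1.
  rewrite !mulr1 !mulr0 => ->; rewrite k10_odd_scale.
  by congr k10_odd; ring.
have m0 : m <> 0.
  move=> e; have := congr1 (fun u : k10_space F => u.2 1 0) fmE.
  by rewrite e linear0 !mxE /= => /eqP; rewrite eq_sym oner_eq0.
have := k10_oddE modd.
set x1 := m.2 1 0; set x2 := m.2 2%:R 0; set y1 := m.2 0 1; set y2 := m.2 0 2%:R.
move=> mE; have [/andP[/eqP x10 /eqP y10]|xy1] := boolP ((x1 == 0) && (y1 == 0)).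
  have [/andP[/eqP x20 /eqP y20]|xy2] := boolP ((x2 == 0) && (y2 == 0)).
    case: m0; rewrite mE x10 y10 x20 y20.
    by apply: k10_ext; rewrite /= ?mxE.
  (* This choice of [n] kills the coordinates of [m n] along 1 and 00; then [(m n) m] is
     [2 (x2^2 - d y2^2)] times the image of [m] under multiplication by the square root of [d]. The
     case below is its mirror image. *)
  have [|mu] := prop (k10_odd (d * y2) 0 (- x2) 0); first exact/k10_part_true.
  rewrite mE /k10_odd !kd_mulE [RHS]k10c_scale => E.
  apply: (square_of_proportional (mu := mu) char2 xy2).
    have := congr1 (fun u : k10_space F => u.2 0 2%:R) E; rewrite !mxE /= => <-.
    by ring.
  have := congr1 (fun u : k10_space F => u.2 2%:R 0) E; rewrite !mxE /= => <-.
  by ring.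
have [|mu] := prop (k10_odd 0 (- d * y1) 0 x1); first exact/k10_part_true.
rewrite mE /k10_odd !kd_mulE [RHS]k10c_scale => E.
apply: (square_of_proportional (mu := mu) char2 xy1).
  have := congr1 (fun u : k10_space F => u.2 0 1) E; rewrite !mxE /= => <-.
  by ring.
have := congr1 (fun u : k10_space F => u.2 1 0) E; rewrite !mxE /= => <-.
by ring.
Qed.

(** * Quadratic extensions *)

Lemma quadratic_extension (F : fieldType) (d : F) : 2%:R != 0 :> F ->
  ~ (exists e, d = e ^+ 2) ->
  exists K : fieldExtType F,
    quadratic_separable K /\ exists z : K, z ^+ 2 = in_alg K d.
Proof.
move=> char2 nsq; pose p := 'X^2 - d%:P : {poly F}.
have sp : size p = 3 by rewrite size_XnsubC.
have [|K dimK [z rz zK]] := @irredp_FAdjoin F p.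
  apply: cubic_irreducible => [|e]; first by rewrite sp.
  apply/negP => /rootP; rewrite !hornerE => /subr0_eq ed.
  by apply: nsq; exists e.
exists K; split; last first.
  exists z; move/rootP: rz; rewrite rmorphB /= map_polyXn map_polyC !hornerE.
  exact: subr0_eq.
rewrite sp in dimK; split=> //; rewrite -zK -adjoin_separable_eq separable_nz_der.
have sm : size (minPoly 1 z) = 3.
  by rewrite size_minPoly /adjoin_degree zK dimv1 divn1 dimK.
(* The derivative of a monic quadratic polynomial has coefficient 2 in degree 1. *)
apply: contraNneq char2 => /(congr1 (fun q : {poly K} => q`_1)).
have /monicP := monic_minPoly 1 z; rewrite lead_coefE sm /= => lc.
rewrite coef_deriv lc coef0 => /eqP.
by rewrite -(rmorph_nat (in_alg K)) fmorph_eq0.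
Qed.

Lemma quadratic_generator (F : fieldType) (K : fieldExtType F) :
  2%:R != 0 :> F -> \dim {:K} = 2 ->
  exists (z : K) (d : F), [/\ z ^+ 2 = d%:A, forall e : F, z != e%:A
    & forall k : K, exists x y : F, k = x%:A + y *: z].
Proof.
move=> char2 dimK.
have [w _ w1] : exists2 w, w \in {:K}%VS & w \notin 1%VS.
  by apply/subvPn/negP => /dimvS; rewrite dimK dimv1.
have full : (1 + <[w]>)%VS = {:K}%VS.
  apply/eqP; rewrite eqEdim subvf dimK ltnNge; apply: contra w1 => le1.
  have /eqP -> : (1 == 1 + <[w]>)%VS by rewrite eqEdim addvSl dimv1.
  by rewrite (subvP (addvSr _ _)) // memv_line.
have dec k : exists x y : F, k = x%:A + y *: w.
  have /memv_addP[u /vlineP[x ->] [v /vlineP[y ->] ->]] : k \in (1 + <[w]>)%VS.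
    by rewrite full memvf.
  by exists x, y.
have [al [be w2]] := dec (w ^+ 2).
(* Completing the square in [w^2 = al + be w]. *)
pose h := be / 2%:R; have hE : be = 2%:R * h by rewrite mulrC divfK.
exists (w - h%:A), (al + h ^+ 2); split=> [|e|k].
- by rewrite sqrrB w2 hE mulr_algr -scalerA scaler_nat addrK exprZn expr1n scalerDl.
- apply: contra w1 => /eqP we; rewrite -[w](subrK h%:A) we -scalerDl.
  by rewrite memvZ ?mem1v.
- have [x [y ->]] := dec k; exists (x + y * h), y.
  by rewrite scalerBr scalerDl scalerA addrC addrCA addrK addrC.
Qed.

Lemma closed_sqrt (L : closedFieldType) (a : L) : exists c, c ^+ 2 = a.
Proof.
have [c /rootP] : exists c, root ('X^2 - a%:P) c.
  by apply/closed_rootP; rewrite size_XnsubC.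
by rewrite !hornerE => /subr0_eq; exists c.
Qed.

Theorem corollary2p2 (F : fieldType) (Fbar : closedFieldType)
    (iota : {rmorphism F -> Fbar})
    (hchar : 2%:R != 0 :> F)
    (halg : forall x : Fbar, algebraicOver iota x) :
  (forall A : superalgebra F, is_twisted_form iota A ->
     is_trivial_form A \/
     exists K : fieldExtType F, quadratic_separable K /\ splits_over K A) /\
  (forall K : fieldExtType F, quadratic_separable K ->
     exists A : superalgebra F,
       [/\ is_twisted_form iota A, ~ is_trivial_form A & splits_over K A] /\
       (forall A' : superalgebra F,
          is_twisted_form iota A' -> ~ is_trivial_form A' -> splits_over K A' ->
          superalgebra_iso A' A)).
Proof.
have triv (A : superalgebra F) (e : F) : e != 0 -> superalgebra_iso (K10d (e ^+ 2)) A -> is_trivial_form A.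
  move=> e0 dA; have [h [_ hP]] := kd_split_iso hchar e0.
  apply: superalgebra_iso_trans (superalgebra_iso_sym dA) _; by exists h.
split=> [A /(iso_over_K10P iota hchar)/(twisted_form_kd hchar)|K [dimK _]].
  move=> [d [c [c0 cd dA]]].
  have d0 : d != 0 by rewrite -(fmorph_eq0 iota) -cd expf_neq0.
  have [[e de]|nsq] := boolp.pselect (exists e, d = e ^+ 2).
    left; apply: (triv _ e); last by rewrite -de.
    by apply: contraNneq d0 => e0; rewrite de e0 expr0n.
  right; have [K [Kq [z zd]]] := quadratic_extension hchar nsq.
  exists K; split=> //; apply/(iso_over_K10P (in_alg K) hchar).
  have [|k kext] := @kd_splits _ _ (in_alg K) hchar d z _ zd.
    by rewrite -sqrf_eq0 zd fmorph_eq0.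
  exact: ext_isol kext (superalgebra_iso_sym dA).
have [z [d [zd zF dec]]] := quadratic_generator hchar dimK.
have z0 : z != 0 by have := zF 0; rewrite scale0r.
have d0 : d != 0 by apply: contraNneq z0 => e; rewrite -sqrf_eq0 zd e scale0r.
(* A root [e] of [d] in F would give [z = e] or [z = - e]. *)
have nsq : ~ exists e, d = e ^+ 2.
  move=> [e de]; have /eqP : z ^+ 2 = (in_alg K e) ^+ 2.
    by rewrite zd de -[LHS]/(in_alg K _) rmorphXn.
  by rewrite eqf_sqr (negPf (zF e)) /= -scaleNr (negPf (zF _)).
exists (K10d d); split; first split.
- apply/(iso_over_K10P iota hchar); have [c cd] := closed_sqrt (iota d).
  by apply: (kd_splits hchar _ cd); rewrite -sqrf_eq0 cd fmorph_eq0.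
- by move=> /(trivial_kd_square hchar).
- by apply/(iso_over_K10P (in_alg K) hchar); apply: (kd_splits hchar z0).
(* The classification is applied with K as the large field: [A'] has a parameter [d'] with a square
   root [c = x + y z] in K. As [c^2] lies in F, [2 x y = 0]; [y = 0] would make [d'] a square in F
   and [A'] trivial, so [x = 0] and [d' = y^2 d]. *)
move=> A' _ ntriv /(iso_over_K10P (in_alg K) hchar)/(twisted_form_kd hchar).
move=> [d' [c [c0 cd dA']]]; have [x [y cE]] := dec c.
have nsq' e : d' = e ^+ 2 -> False.
  move=> de; apply: ntriv; apply: (triv _ e); last by rewrite -de.
  apply: contraNneq c0 => e0; move: cd; rewrite de e0 expr0n rmorph0 => /eqP.
  by rewrite sqrf_eq0.
have c2 : c ^+ 2 = (x ^+ 2 + y ^+ 2 * d)%:A + (2%:R * x * y) *: z.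
  rewrite cE sqrrD !exprZn expr1n zd mulr_algl -scaler_nat !scalerA addrAC.
  by rewrite -scalerDl.
have xy0 : 2%:R * x * y = 0.
  apply/eqP/negPn/negP => n0.
  have /eqP[] := zF ((d' - (x ^+ 2 + y ^+ 2 * d)) / (2%:R * x * y)).
  rewrite mulrC -scalerA scalerBl -[d'%:A]/(in_alg K d') -cd c2 addrAC subrr add0r.
  by rewrite scalerA mulVf // scale1r.
have x0 : x = 0.
  move/eqP: xy0; rewrite !mulf_eq0 (negPf hchar) /= => /orP[/eqP//|/eqP y0].
  case: (nsq' x); apply: (fmorph_inj (in_alg K)); rewrite -cd c2 y0.
  by rewrite expr0n mul0r addr0 mulr0 scale0r addr0.
have dy : d' = y ^+ 2 * d.
  apply: (fmorph_inj (in_alg K)); rewrite -cd c2 x0.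
  by rewrite expr0n add0r mulr0 mul0r scale0r addr0.
have y0 : y != 0.
  by apply: contraNneq c0 => y0; rewrite cE x0 y0 !scale0r addr0.
apply: superalgebra_iso_trans (superalgebra_iso_sym dA') _.
by rewrite dy; apply: kd_rescale_iso.
Qed.
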